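(* Let $\phi=(f_0:f_1:f_2):\mathbb{P}^1\to\mathbb{P}^2$ be a generically $1$-to-$1$ parametrization of a rational plane curve $\mathcal{C}:F=0$ of degree $d\geq 2$ over $\mathbb{C}$. For $q\geq 0$ let $$a(q)=\dim\ker\{\phi^2_{q+2}:\Omega^2(\mathbb{C}^3)_{q+2}\to\Omega^2(\mathbb{C}^2)_{(q+2)d}\},$$ where $\phi^2_{q+2}$ is the pull-back of $2$-forms under $(f_0,f_1,f_2)$. Then $$a(q)=\dim ARE(F)_q=\binom{q+1}{2}+\dim AR(F)_q.$$ Moreover, the following properties hold. \begin{itemize} \item[i)] The integer $r=mdr(F)$ is determined by the properties: $a(q)=\binom{q+1}{2}$ for all $0\leq q<r$ and $a(r)>\binom{r+1}{2}$. \item[ii)] The curve $\mathcal{C}:F=0$ is free if and only if $2r\leq d-1$ and $$a(d-r-1)=\binom{d-r}{2}+\binom{d-2r+1}{2}+1.$$ \item[iii)] The curve $\mathcal{C}:F=0$ is nearly free if and only if $2r\leq d$ and $$a(d-r)=\binom{d-r+1}{2}+\binom{d-2r+2}{2}+2.$$ \end{itemize}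
   Context: Here $f_0,f_1,f_2\in\mathbb{C}[s,t]$ are homogeneous of the same degree $d$ with $\gcd(f_0,f_1,f_2)=1$, $\mathcal{C}$ is the image of $\phi$, and generically $1$-to-$1$ means that the fiber over a generic point of $\mathcal{C}$ is a single point (so $\deg\mathcal{C}=d$). Let $S=\mathbb{C}[x,y,z]$ and let $F\in S_d$ be a (reduced) defining equation of $\mathcal{C}$. Forms: $\Omega^2(\mathbb{C}^2)$ and $\Omega^2(\mathbb{C}^3)$ are the graded modules of global differential $2$-forms with polynomial coefficients on $\mathbb{C}^2$ (coordinates $s,t$) and $\mathbb{C}^3$ (coordinates $x,y,z$), graded so that the coordinates and their differentials all have degree $1$; a subscript denotes the homogeneous component of that degree. The pull-back substitutes $x=f_0,y=f_1,z=f_2$ (and $\mathrm{d}x=\mathrm{d}f_0$, etc.). Syzygies: $AR(F)=\{(a,b,c)\in S^3: aF_x+bF_y+cF_z=0\}$ and $ARE(F)=\{(a,b,c)\in S^3: aF_x+bF_y+cF_z\in(F)\}$ are graded $S$-modules in which $(a,b,c)$ has degree $k$ if $a,b,c\in S_k$. $mdr(F)=\min\{q: AR(F)_q\neq 0\}$. Freeness: $\mathcal{C}$ is free (with exponents $d_1\leq d_2$) if $AR(F)$ is a free graded $S$-module of rank two with a homogeneous basis of degrees $d_1,d_2$. $\mathcal{C}$ is nearly free (with exponents $d_1\leq d_2$) if $AR(F)$ is generated by three homogeneous syzygies $r_1,r_2,r_3$ of degrees $d_1,d_2,d_3$ with $d_3=d_2$, and the syzygies among $r_1,r_2,r_3$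 are generated by a single relation $hr_1+\ell r_2+\ell' r_3=0$ with $\ell,\ell'$ independent linear forms and $h\in S_{d_2+1-d_1}$. *)

(* Defs.v *)
From HB Require Import structures.
From mathcomp Require Import all_boot all_order all_algebra.
From mathcomp Require Import boolp classical_sets reals complex.
From mathcomp Require Import mpoly.

Set Implicit Arguments.
Unset Strict Implicit.
Unset Printing Implicit Defensive.

Import Order.TTheory GRing.Theory Num.Theory.
Local Open Scope ring_scope.

(* The subspace with underlying set P; junk value 0 when P is not a subspace. *)
Definition subspace_of (K : fieldType) (V : vectType K) (P : V -> Prop) :
    {vspace V} :=
  xget 0%VS [set U : {vspace V} | forall v, v \in U <-> P v].

Definition linear_subset (K : fieldType) (V : lmodType K) (P : V -> Prop) :=
  P 0 /\ forall (c : K) u v, P u -> P v -> P (c *: u + v).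

Lemma mem_subspace_of (K : fieldType) (V : vectType K) (P : V -> Prop) :
  linear_subset P -> forall v, v \in subspace_of P <-> P v.
Proof.
case=> P0 PD; rewrite /subspace_of.
suff exU : exists U : {vspace V}, forall v, v \in U <-> P v.
  exact: (@xgetPex _ 0%VS [set U : {vspace V} | forall v, v \in U <-> P v] exU).
pose Q n := `[< exists2 U : {vspace V}, \dim U = n & forall v, v \in U -> P v >].
have exQ : exists n, Q n.
  exists 0%N; apply/asboolP; exists 0%VS; first by rewrite dimv0.
  by move=> v; rewrite memv0 => /eqP->.
have ubQ n : Q n -> (n <= dim V)%N.
  by move=> /asboolP[U <- _]; rewrite -dimvf; apply/dimvS/subvf.
case: (ex_maxnP exQ ubQ) => n /asboolP[U dimU UP] maxn.
exists U => v; split=> [/UP//|Pv]; apply: contrapT => /negP vNU.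
suff /maxn : Q n.+1 by rewrite ltnn.
apply/asboolP; exists (U + <[v]>)%VS; last first.
  move=> w /memv_addP[u /UP Pu [_ /vlineP[c ->] ->]].
  by rewrite addrC; apply: PD.
rewrite dimv_disjoint_sum ?dimU ?dim_vline; last first.
  apply/eqP; rewrite -subv0; apply/subvP => w /memv_capP[wU /vlineP[c wE]].
  rewrite memv0 wE; have [-> | c0] := eqVneq c 0; first by rewrite scale0r.
  by case/negP: vNU; rewrite -[v](scalerK c0) -wE memvZ.
by have [v0|_] := eqVneq v 0; [rewrite v0 mem0v in vNU | rewrite addn1].
Qed.

Section Polynomials.
Variables (K : fieldType) (n : nat).
Local Notation S := {mpoly K[n]}.

Definition mdivides (g p : S) : Prop := exists h : S, p = h * g.

Definition gcd_is_one (k : nat) (f : k.-tuple S) : Prop :=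
  forall g : S, (forall i, mdivides g (tnth f i)) -> g \is a GRing.unit.

Definition squarefree (p : S) : Prop :=
  forall g : S, mdivides (g ^+ 2) p -> g \is a GRing.unit.

Definition homog_mx (q k l : nat) (A : 'M[S]_(k, l)) : Prop :=
  forall i j, A i j \is q.-homog.

End Polynomials.

(* Homogeneous components of a graded submodule P of the free S-module of     *)
(* k x l matrices, as subspaces of a finite dimensional K-vector space.       *)
Section HomogeneousComponents.
Variables (K : fieldType) (n : nat).
Local Notation S := {mpoly K[n.+1]}.

Local Notation dhomog_mx k l q := {ffun 'I_k * 'I_l -> dhomog n.+1 K q}.

Definition mx_of_dhomog (k l q : nat) (v : dhomog_mx k l q) : 'M[S]_(k, l) :=
  \matrix_(i, j) mpoly_of_dhomog (v (i, j)).

Definition homog_part (k l : nat) (P : 'M[S]_(k, l) -> Prop) (q : nat) :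
    {vspace dhomog_mx k l q} :=
  subspace_of (fun v : dhomog_mx k l q => P (mx_of_dhomog v)).

Definition linear_mx_subset (k l : nat) (P : 'M[S]_(k, l) -> Prop) :=
  P 0 /\ forall (c : K) A B, P A -> P B -> P (c%:MP *: A + B).

Lemma mem_homog_part (k l : nat) (P : 'M[S]_(k, l) -> Prop) q :
  linear_mx_subset P ->
  forall v, v \in homog_part P q <-> P (mx_of_dhomog v).
Proof.
case=> P0 PD v; apply: mem_subspace_of; split.
  suff -> : @mx_of_dhomog k l q 0 = 0 by [].
  by apply/matrixP => i j; rewrite !mxE ffunE.
move=> c u w Pu Pw.
suff -> : mx_of_dhomog (c *: u + w) =
          c%:MP *: mx_of_dhomog u + mx_of_dhomog w by apply: PD.
by apply/matrixP => i j; rewrite !mxE !ffunE /= mul_mpolyC.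
Qed.

Lemma homog_part_neq0 (k l q : nat) (P : 'M[S]_(k, l) -> Prop) (A : 'M[S]_(k, l)) :
  linear_mx_subset P -> P A -> homog_mx q A -> A != 0 ->
  homog_part P q != 0%VS.
Proof.
move=> linP PA hA; apply: contraNneq => P0.
pose v : dhomog_mx k l q := [ffun ij => DHomog (hA ij.1 ij.2)].
have vA : mx_of_dhomog v = A by apply/matrixP => i j; rewrite mxE ffunE.
have : v \in homog_part P q by rewrite (mem_homog_part linP) vA.
rewrite P0 memv0 -vA => /eqP->.
by apply/eqP/matrixP => i j; rewrite !mxE ffunE.
Qed.

End HomogeneousComponents.

Section Syzygies.
Variable K : fieldType.
Local Notation S := {mpoly K[3]}.

Definition grad_pairing (F : S) (a : 'rV[S]_3) : S :=
  \sum_(i < 3) a 0 i * F^`M(i).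

Definition AR (F : S) (a : 'rV[S]_3) : Prop := grad_pairing F a = 0.

Definition ARE (F : S) (a : 'rV[S]_3) : Prop := mdivides F (grad_pairing F a).

Definition mdr (F : S) : nat :=
  xget 0%N [set q | homog_part (AR F) q != 0%VS /\
     forall q', homog_part (AR F) q' != 0%VS -> (q <= q')%N].

Definition free_curve_exp (F : S) (d1 d2 : nat) : Prop :=
  (d1 <= d2)%N /\
  exists r1 r2 : 'rV[S]_3,
    [/\ AR F r1 /\ homog_mx d1 r1, AR F r2 /\ homog_mx d2 r2 &
        forall a, AR F a -> exists! u : S * S, a = u.1 *: r1 + u.2 *: r2].

Definition free_curve (F : S) : Prop := exists d1 d2, free_curve_exp F d1 d2.

Definition nearly_free_curve_exp (F : S) (d1 d2 : nat) : Prop :=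
  (d1 <= d2)%N /\
  exists r1 r2 r3 : 'rV[S]_3,
    [/\ AR F r1 /\ homog_mx d1 r1, AR F r2 /\ homog_mx d2 r2,
        AR F r3 /\ homog_mx d2 r3,
        forall a, AR F a ->
          exists u1 u2 u3 : S, a = u1 *: r1 + u2 *: r2 + u3 *: r3 &
        exists h l l' : S,
          [/\ h \is (d2 + 1 - d1).-homog, l \is 1.-homog /\ l' \is 1.-homog,
              forall c c' : K, c *: l + c' *: l' = 0 -> c = 0 /\ c' = 0,
              h *: r1 + l *: r2 + l' *: r3 = 0 &
              forall u1 u2 u3 : S, u1 *: r1 + u2 *: r2 + u3 *: r3 = 0 ->
                exists g : S, [/\ u1 = g * h, u2 = g * l & u3 = g * l']]].

Definition nearly_free_curve (F : S) : Prop :=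
  exists d1 d2, nearly_free_curve_exp F d1 d2.

Lemma grad_pairing_linear (F : S) (c : K) a b :
  grad_pairing F (c%:MP *: a + b) =
  c%:MP * grad_pairing F a + grad_pairing F b.
Proof.
rewrite /grad_pairing mulr_sumr -big_split /=; apply: eq_bigr => i _.
by rewrite !mxE mulrDl mulrA.
Qed.

Lemma grad_pairing0 (F : S) : grad_pairing F 0 = 0.
Proof. by rewrite /grad_pairing big1 // => i _; rewrite mxE mul0r. Qed.

Lemma AR_linear (F : S) : linear_mx_subset (AR F).
Proof.
split=> [|c a b aF bF]; first exact: grad_pairing0.
by rewrite /AR grad_pairing_linear aF bF mulr0 addr0.
Qed.

Lemma ARE_linear (F : S) : linear_mx_subset (ARE F).
Proof.
split=> [|c a b [g gE] [h hE]].
  by exists 0; rewrite mul0r; exact: grad_pairing0.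
by exists (c%:MP * g + h); rewrite grad_pairing_linear gE hE mulrDl mulrA.
Qed.

Lemma mderiv_homog (F : S) (d : nat) (i : 'I_3) :
  F \is d.-homog -> F^`M(i) \is d.-1.-homog.
Proof.
move=> /dhomogP dF; rewrite /mderiv big_seq; apply: rpred_sum => m /dF /= mF.
have [->|m0] := eqVneq (m i) 0%N; first by rewrite mul0r scale0r rpred0.
rewrite rpredZ // dhomogX -mF -{2}(@submK _ U_(i)%MM m) ?lep1mP //.
by rewrite mdegD mdeg1 addn1.
Qed.

Lemma mdrP (F : S) (d : nat) : F \is d.-homog ->
  homog_part (AR F) (mdr F) != 0%VS /\
  forall q, homog_part (AR F) q != 0%VS -> (mdr F <= q)%N.
Proof.
move=> dF.
suff exq : exists q, homog_part (AR F) q != 0%VS.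
  apply: (@xgetPex _ 0%N [set q | homog_part (AR F) q != 0%VS /\
    forall q', homog_part (AR F) q' != 0%VS -> (q <= q')%N]).
  by case: (ex_minnP exq) => q; exists q.
have [F0|] := eqVneq (\row_i F^`M(i)) (0 : 'rV[S]_3).
  exists 0%N; apply: (@homog_part_neq0 _ _ _ _ _ _ (const_mx 1)).
  - exact: AR_linear.
  - rewrite /AR /grad_pairing big1 // => i _.
    by move/matrixP: F0 => /(_ 0 i); rewrite !mxE => ->; rewrite mulr0.
  - by move=> i j; rewrite mxE; apply: dhomog1.
  - by apply/eqP => /matrixP/(_ 0 0); rewrite !mxE; apply/eqP/oner_neq0.
move=> /eqP/rowP F0; have /existsP[i Fi] : [exists i : 'I_3, F^`M(i) != 0].
  apply: contrapT => /negP; rewrite negb_exists => /forallP Fi; apply: F0 => i.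
  by rewrite !mxE; apply/eqP; have := Fi i; rewrite negbK.
have [j ji] : exists j : 'I_3, j != i by exists (i + 1); rewrite addrC -subr_eq0 addrK.
exists d.-1; apply: (@homog_part_neq0 _ _ _ _ _ _
  (\row_k (if k == j then F^`M(i) else if k == i then - F^`M(j) else 0))).
- exact: AR_linear.
- rewrite /AR /grad_pairing (bigD1 j) //= (bigD1 i) /=; last by rewrite eq_sym.
  rewrite big1 => [|k /andP[/negPf kj /negPf ki]]; last first.
    by rewrite mxE kj ki mul0r.
  by rewrite !mxE eqxx eq_sym (negPf ji) eqxx mulNr mulrC addr0 subrr.
- move=> k l; rewrite mxE; case: ifP => _; first exact: mderiv_homog.
  by case: ifP => _; rewrite ?rpredN ?rpred0 ?mderiv_homog.
- apply/eqP => /matrixP/(_ 0 j); rewrite !mxE eqxx => Fi0.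
  by rewrite Fi0 eqxx in Fi.
Qed.

End Syzygies.

(* A 2-form sum_(i < j) w_ij dx_i /\ dx_j is encoded as the alternating      *)
(* matrix (w_ij); a 1-form is the row of its coefficients.                    *)
Section TwoForms.
Variable K : fieldType.

Definition is_2form (n : nat) (w : 'M[{mpoly K[n]}]_n) : Prop :=
  forall i j, w i i = 0 /\ w j i = - w i j.

Definition mdiff (n : nat) (p : {mpoly K[n]}) : 'rV[{mpoly K[n]}]_n :=
  \row_i p^`M(i).

Definition wedge (n : nat) (a b : 'rV[{mpoly K[n]}]_n) : 'M[{mpoly K[n]}]_n :=
  \matrix_(i, j) (a 0 i * b 0 j - a 0 j * b 0 i).

Definition pullback (m n : nat) (f : n.-tuple {mpoly K[m]})
    (w : 'M[{mpoly K[n]}]_n) : 'M[{mpoly K[m]}]_m :=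
  \sum_(i < n) \sum_(j < n | (i < j)%N)
     (w i j \mPo f) *: wedge (mdiff (tnth f i)) (mdiff (tnth f j)).

Definition pullback_ker (m n : nat) (f : n.-tuple {mpoly K[m]})
    (w : 'M[{mpoly K[n]}]_n) : Prop :=
  is_2form w /\ pullback f w = 0.

(* As the dx_i have degree 1, the component of degree q + 2 of the 2-forms    *)
(* consists of the forms with coefficients homogeneous of degree q.           *)
Definition dim_pullback_ker (m : nat) (f : 3.-tuple {mpoly K[m]}) (q : nat) :
    nat :=
  \dim (homog_part (pullback_ker f) q).

Lemma pullback_ker_linear (m n : nat) (f : n.+1.-tuple {mpoly K[m]}) :
  linear_mx_subset (pullback_ker f).
Proof.
split=> [|c v w [v2 vf] [w2 wf]]; split.
- by move=> i j; rewrite !mxE oppr0.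
- rewrite /pullback big1 // => i _; rewrite big1 // => j _.
  by rewrite mxE raddf0 scale0r.
- move=> i j; rewrite !mxE; case: (v2 i j) => -> ->; case: (w2 i j) => -> ->.
  by rewrite mulr0 addr0 mulrN opprD.
rewrite -[RHS]addr0 -{1}[0 in RHS](scaler0 _ c%:MP) -{1}vf -wf /pullback.
rewrite scaler_sumr -big_split; apply: eq_bigr => i _ /=.
rewrite scaler_sumr -big_split; apply: eq_bigr => j _ /=.
by rewrite !mxE rmorphD rmorphM /= comp_mpolyC scalerDl scalerA.
Qed.

End TwoForms.

(* Points of projective space are nonzero row vectors up to proportionality.  *)
Section Parametrizations.
Variable K : fieldType.

Definition proj_eq (n : nat) (u v : 'rV[K]_n) : Prop :=
  exists2 c : K, c != 0 & v = c *: u.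

Definition eval_map (m n : nat) (f : n.-tuple {mpoly K[m]}) (u : 'rV[K]_m) :
    'rV[K]_n :=
  \row_i (tnth f i).@[u 0].

(* The fibre over p is a single point for every p of the image lying in some  *)
(* basic open set G <> 0 that meets the image.                                *)
Definition generically_injective (f : 3.-tuple {mpoly K[2]}) : Prop :=
  exists (e : nat) (G : {mpoly K[3]}),
    [/\ G \is e.-homog,
        exists2 u : 'rV[K]_2, u != 0 & G.@[eval_map f u 0] != 0 &
        forall u v : 'rV[K]_2, u != 0 -> v != 0 ->
          G.@[eval_map f u 0] != 0 ->
          proj_eq (eval_map f u) (eval_map f v) -> proj_eq u v].

Definition reduced_equation (f : 3.-tuple {mpoly K[2]}) (F : {mpoly K[3]}) :
    Prop :=
  squarefree F /\
  forall p : 'rV[K]_3, p != 0 ->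
    (F.@[p 0] = 0 <->
     exists2 u : 'rV[K]_2, u != 0 & proj_eq (eval_map f u) p).

End Parametrizations.

(* Main.v *)
Require Import Defs.
From HB Require Import structures.
From mathcomp Require Import all_boot all_order all_algebra.
From mathcomp Require Import perm separable.
From mathcomp Require Import boolp classical_sets reals complex.
From mathcomp Require Import mpoly.
From mathcomp Require Import ring zify.

Set Implicit Arguments.
Unset Strict Implicit.
Unset Printing Implicit Defensive.

Import Order.TTheory GRing.Theory Num.Theory.
Local Open Scope ring_scope.

(** Let [S] be the polynomial ring in [x], [y], [z] over the algebraically closed
    field [K] of characteristic 0.

    Kernel of the parametrization.  A polynomial [P] with [P \mPo f = 0] is a
    multiple of [F] ([parametrization_kernel]).  In coordinates where [F] is monic
    in [z], divide [P] by [F].  Over a general point of the [(x, y)]-plane lie [d]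
    distinct points of the cone over the curve: the form [y f0 - x f1] has [d]
    simple zeros because the Wronskian of [f0] and [f1] is not zero, and their
    images differ by generic injectivity.  The remainder, of degree less than [d]
    in [z], vanishes at these [d] points, hence is zero.  In particular [F] is
    prime.

    2-forms.  A 2-form on the 3-space is a vector field [a], and its pull-back
    vanishes if and only if, along the curve, [a] is orthogonal to the vector of
    minors of the Jacobian matrix of [f].  By the chain rule this vector is
    parallel to the gradient of [F] along the curve, and neither of them is zero.
    So the condition is that [F] divides the pairing of [a] with its gradient,
    that is, [a] belongs to [ARE F] ([dim_pullback_ker_ARE]).  The Euler field
    splits [ARE F] into [AR F] and a free module of rank one ([dim_ARE]), and this
    gives the formula for [a(q)] and the first property.

    Syzygies.  As [F] is prime, a vector that is parallel to the gradient is a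
    multiple of it ([parallel_gradient]); so two syzygies [a] and [b] have a
    factor [h], with [cross a b] equal to [h] times the gradient, and degrees
    satisfy [deg a + deg b = d - 1 + deg h].  Let [r1] be a syzygy of minimal
    degree [r].  The syzygies parallel to [r1] are its multiples
    ([minimal_syzygy_sat]), and hence the factor against [r1] identifies the
    quotient of [AR F] by [r1] with an ideal of [S].  The curve is free when this
    ideal is the unit ideal, and nearly free when it is generated by two
    independent linear forms.  The numerical conditions say that the ideal contains
    a nonzero constant (degree [d - r - 1] of [AR F]), respectively that its linear
    forms are a 2-dimensional space (degree [d - r] of [AR F]); in the latter case
    a regular sequence argument shows that the ideal is not larger than the one
    generated by these forms ([generated_or_free]).

    Divisibility in polynomial rings enters through primitive vectors: every vector
    is a multiple of a primitive one ([mpoly_primitive_parts]), which replaces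
    unique factorization throughout. *)

(** * Primitive vectors *)

(** Over a unique factorization domain this says that the entries of [c] have
    no common factor, unless [c] vanishes.  The divisibility is phrased through
    proportional vectors, so that neither primes nor gcds enter. *)
Definition primitive (R : comNzRingType) (I : Type) (c : I -> R) : Prop :=
  forall (e h : R) (b : I -> R), e != 0 -> (forall i, e * b i = h * c i) ->
  exists k, forall i, b i = k * c i.

Definition has_primitive_parts (R : comNzRingType) : Prop :=
  forall (I : finType) (a : I -> R),
  exists (g : R) (c : I -> R), primitive c /\ forall i, a i = g * c i.

Lemma field_primitive_parts (K : fieldType) : has_primitive_parts K.
Proof.
move=> I a; exists 1, a; split=> [e h b e0 eb|i]; last by rewrite mul1r.
by exists (e^-1 * h) => i; rewrite -mulrA -eb mulKf.
Qed.

Lemma dvd_coefP (R : nzRingType) (e : R) (p : {poly R}) :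
  (forall l, exists t, p`_l = e * t) <-> exists q, p = e *: q.
Proof.
split=> [ep|[q ->] l]; last by exists q`_l; rewrite coefZ.
have [t tE] := choice ep; exists (\poly_(l < size p) t l).
apply/polyP => l; rewrite coefZ coef_poly; case: ltnP => [_|lp]; first exact: tE.
by rewrite mulr0 nth_default.
Qed.

Section GaussLemma.
Variables (R : idomainType) (I : finType) (n : nat) (c : I -> {poly R}).
Hypothesis size_c : forall i, (size (c i) <= n)%N.
Hypothesis c_neq0 : exists i, c i != 0.
Hypothesis c_prim : primitive (fun ij : I * 'I_n => (c ij.1)`_ij.2).

(** Gauss's lemma for vectors, by McCoy's argument: were [h] a zero divisor of
    [c] modulo [e], so would be the products of [h] by the coefficients of [c];
    from the top coefficient down, each of these has smaller degree than [h]
    modulo [e], hence vanishes modulo [e] by induction, and primitivity of the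
    vector of all coefficients of [c] then gives that [e] divides [h]. *)
Lemma gauss_dvd (e : R) (h : {poly R}) : e != 0 ->
  (forall i l, exists t, (h * c i)`_l = e * t) ->
  forall l, exists t, h`_l = e * t.
Proof.
move=> e0; pose D (x : R) := exists t, x = e * t.
have D0 : D 0 by exists 0; rewrite mulr0.
have DB x y : D x -> D y -> D (x - y).
  by move=> [s ->] [t ->]; exists (s - t); rewrite mulrBr.
have DD x y : D x -> D y -> D (x + y).
  by move=> [s ->] [t ->]; exists (s + t); rewrite mulrDr.
have DM x y : D x -> D (y * x) by move=> [t ->]; exists (y * t); rewrite mulrCA.
have [m] := ubnP (size h); elim: m h => // m IH h /ltnSE hm ehc.
have [->|h0] := eqVneq h 0; first by move=> l; rewrite coef0.
pose k := (size h).-1; pose h' := take_poly k h.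
have kh : k.+1 = size h by rewrite prednK // size_poly_gt0.
have hE l : h`_l = h'`_l + (l == k)%:R * h`_k.
  rewrite coef_take_poly; case: (ltngtP l k) => [_|lk|->]; rewrite ?mul0r ?mul1r ?addr0 ?add0r //.
  by rewrite nth_default // -kh.
have h'm : (size h' < m)%N.
  by apply: leq_trans hm; rewrite -kh ltnS size_take_poly.
have ech i j l : D ((c i)`_j * h`_l).
  have [a] := ubnP (n - j); elim: a j l => // a IHa j l /ltnSE ja.
  have [nj|jn] := leqP n j; first by rewrite nth_default ?mul0r // (leq_trans _ nj).
  have ecj s j' : (j < j')%N -> D ((c i)`_j' * h`_s).
    by move=> jj'; apply: IHa; rewrite (leq_trans _ ja) // ltn_sub2l.
  (* Modulo [e], only this product contributes to the coefficient of degree [k + j]. *)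
  have etop : D ((c i)`_j * h`_k).
    have := ehc i (k + j)%N; rewrite coefM -/(D _).
    rewrite (bigD1 (inord k)) //= inordK ?ltnS ?leq_addr // addKn mulrC => eS.
    rewrite -[X in D X](addrK (\sum_(s < (k + j).+1 | s != inord k) h`_s * (c i)`_(k + j - s))).
    apply: (DB _ _ eS); apply: big_ind => // s sk.
    have [ks|sk'] := ltnP k s; first by rewrite nth_default ?mul0r // -kh.
    rewrite mulrC; apply: ecj; rewrite ltn_subRL ltn_add2r ltn_neqAle sk' andbT.
    by apply: contraNneq sk => sk; apply/eqP/val_inj; rewrite /= inordK // ltnS leq_addr.
  have := IH ((c i)`_j *: h').
  rewrite hE mulrDr => /(_ _ _ l); rewrite coefZ => IHj.
  apply: DD; last by rewrite mulrCA; apply: DM.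
  apply: IHj => [|i' l']; first exact: leq_ltn_trans (size_scale_leq _ _) _.
  have -> : (c i)`_j *: h' = (c i)`_j *: h - ((c i)`_j * h`_k) *: 'X^k.
    apply/polyP => s; rewrite coefB !coefZ coefXn (hE s) mulrDr -mulrA.
    by rewrite [h`_k * _]mulrC addrK.
  rewrite mulrBl coefB -scalerAl coefZ -scalerAl coefZ.
  apply: DB; first by apply: DM; apply: ehc.
  by rewrite mulrC; apply: DM.
move=> l; have [i ci0] := c_neq0.
have [t tE] := choice (fun ij : I * 'I_n => ech ij.1 ij.2 l).
have [s sE] : exists s, forall ij, t ij = s * (c ij.1)`_ij.2.
  by apply: (c_prim e0) => ij; rewrite -tE mulrC.
have ln : (lead_coef (c i) != 0) by rewrite lead_coef_eq0.
have ltn : ((size (c i)).-1 < n)%N.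
  by rewrite prednK ?size_poly_gt0.
have := tE (i, Ordinal ltn); rewrite sE /= -/(lead_coef _) => E.
by exists s; apply: (mulfI ln); rewrite E [s * _]mulrC mulrCA.
Qed.

End GaussLemma.

(** Among the nonzero vectors proportional to [a], take one of minimal degree
    and divide it by the content of its coefficients.  Pseudo-division by it
    leaves no remainder, by minimality, and Gauss's lemma removes the power of
    the leading coefficient which pseudo-division introduces. *)
Lemma poly_primitive_parts (R : idomainType) :
  has_primitive_parts R -> has_primitive_parts {poly R}.
Proof.
move=> primR I a.
have [[i0 ai0]|a0] := EM (exists i0, a i0 != 0); last first.
  exists 1, a; split=> [e h b e0 eb|i]; last by rewrite mul1r.
  have {}a0 i : a i = 0 by apply: contrapT => /eqP ai; apply: a0; exists i.
  exists 0 => i; rewrite mul0r; apply: (mulfI e0).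
  by rewrite eb a0 !mulr0.
pose N b := forall i j, a i * b j = a j * b i.
have N_eq0 b : N b -> b i0 = 0 -> forall i, b i = 0.
  by move=> Nb bi0 i; apply: (mulfI ai0); rewrite Nb bi0 !mulr0.
pose Q m := `[< exists b, [/\ N b, b i0 != 0 & size (b i0) = m] >].
have exQ : exists m, Q m.
  by exists (size (a i0)); apply/asboolP; exists a; split=> // i j; rewrite mulrC.
case: (ex_minnP exQ) => m /asboolP[b [Nb bi0 sb]] minm.
pose n := (\max_i size (b i))%N.
have bn i : (size (b i) <= n)%N by apply: leq_bigmax.
have [g [gam [prim_gam gamE]]] := primR _ (fun ij : I * 'I_n => (b ij.1)`_ij.2).
pose c i := \poly_(j < n) oapp (fun j' : 'I_n => gam (i, j')) 0 (insub j).
have cE i (j : 'I_n) : (c i)`_j = gam (i, j) by rewrite coef_poly ltn_ord valK.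
have bE i : b i = g *: c i.
  apply/polyP => l; rewrite coefZ; have [ln|nl] := ltnP l n.
    by rewrite (cE i (Ordinal ln)) -gamE.
  by rewrite !nth_default ?mulr0 // ?(leq_trans (bn i)) // (leq_trans (size_poly _ _)).
have g0 : g != 0 by apply: contraNneq bi0; rewrite bE => ->; rewrite scale0r.
have gP0 : g%:P != 0 by rewrite polyC_eq0.
have Nc : N c.
  move=> i j; apply: (mulfI gP0); rewrite [LHS]mulrCA [RHS]mulrCA.
  by rewrite !mul_polyC -!bE Nb.
have ci0 : c i0 != 0 by apply: contraNneq bi0; rewrite bE => ->; rewrite scaler0.
have sc : size (c i0) = m by rewrite -sb bE size_scale.
have prim_c : primitive (fun ij : I * 'I_n => (c ij.1)`_ij.2).
  move=> e h b' e0 eb; have {}eb ij : e * b' ij = h * gam ij.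
    by case: ij => i j; rewrite eb cE.
  have [k kE] := prim_gam e h b' e0 eb.
  by exists k => -[i j]; rewrite kE cE.
have c_gen b' : N b' -> exists q, forall i, b' i = q * c i.
  move=> Nb'; pose e := lead_coef (c i0) ^+ scalp (b' i0) (c i0).
  have e0 : e != 0 by rewrite expf_neq0 ?lead_coef_eq0.
  pose q := b' i0 %/ c i0; pose rho i := e *: b' i - q * c i.
  have Nrho : N rho.
    move=> i j; rewrite /rho !mulrBr -!scalerAr Nb'; congr (_ - _).
    by rewrite !(mulrCA _ q) Nc.
  have rho0 : rho i0 = b' i0 %% c i0.
    by rewrite /rho Pdiv.Idomain.divp_eq addrAC subrr add0r.
  have {}rho0 : rho i0 = 0.
    apply: contrapT => /eqP rhoN0.
    have : Q (size (rho i0)) by apply/asboolP; exists rho; split.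
    by move=> /minm; rewrite leqNgt rho0 -sc Pdiv.Idomain.ltn_modp ci0.
  have eb' i : e *: b' i = q * c i.
    by apply/eqP; rewrite -subr_eq0; rewrite -/(rho i) N_eq0.
  have [|q' qE] := (dvd_coefP e q).1.
    apply: (@gauss_dvd R I n c _ _ prim_c e q) => // [i||i l].
    - by rewrite /c size_poly.
    - by exists i0.
    - by exists (b' i)`_l; rewrite -eb' coefZ.
  exists q' => i; have eP0 : e%:P != 0 by rewrite polyC_eq0.
  by apply: (mulfI eP0); rewrite !mul_polyC eb' qE scalerAl.
have [g' aE] := c_gen a (fun i j => mulrC _ _).
exists g', c; split=> // e h b' e0 eb'; apply: c_gen => i j; apply: (mulfI e0).
by rewrite [LHS]mulrCA [RHS]mulrCA !eb' [LHS]mulrCA [RHS]mulrCA Nc.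
Qed.

Lemma iso_primitive_parts (R R' : comNzRingType) (phi : {rmorphism R -> R'})
    (psi : {rmorphism R' -> R}) :
  cancel phi psi -> cancel psi phi -> has_primitive_parts R' -> has_primitive_parts R.
Proof.
move=> phiK psiK primR I a; have [g [c [prim_c cE]]] := primR I (phi \o a).
exists (psi g), (psi \o c); split=> [e h b e0 eb|i]; last first.
  by rewrite /= -rmorphM -cE phiK.
have [||k kE] := prim_c (phi e) (phi h) (phi \o b).
- by apply: contraNneq e0 => /(congr1 psi); rewrite phiK rmorph0 => ->.
- by move=> i; rewrite /= -!rmorphM eb rmorphM /= psiK.
- by exists (psi k) => i; rewrite /= -rmorphM -kE /= phiK.
Qed.

Section UnivariateView.
Variables (n : nat) (R : comNzRingType).

Lemma mwiden_comm : commr_rmorph (@mwiden n R) 'X_ord_max.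
Proof. by move=> p; apply: mulrC. Qed.

Definition unmuni : {rmorphism {poly {mpoly R[n]}} -> {mpoly R[n.+1]}} :=
  horner_morph mwiden_comm.

Lemma unmuniC (p : {mpoly R[n]}) : unmuni p%:P = mwiden p.
Proof. exact: horner_morphC. Qed.

Lemma unmuniX : unmuni 'X = 'X_ord_max.
Proof. exact: horner_morphX. Qed.

Lemma muniX_max : muni 'X_ord_max = 'X :> {poly {mpoly R[n]}}.
Proof.
rewrite muniE msuppX big_seq1 mcoeffX eqxx scale1r mnm1E eqxx expr1.
set m := [multinom _ | _ < _]; suff -> : m = 0%MM by rewrite mpolyX0 scale1r.
apply/mnmP => i; rewrite mnmE mnm0E mnm1E.
by case: eqP => // /(congr1 val) /= /eqP; rewrite gtn_eqF.
Qed.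

Lemma muniX_widen (i : 'I_n) :
  muni 'X_(widen_ord (leqnSn n) i) = ('X_i)%:P :> {poly {mpoly R[n]}}.
Proof.
rewrite muniE msuppX big_seq1 mcoeffX eqxx scale1r mnm1E.
rewrite -mul_polyC.
have -> : (widen_ord (leqnSn n) i == ord_max) = false.
  by apply/eqP => /(congr1 val) /= /eqP; rewrite ltn_eqF.
rewrite expr0 mulr1; congr ('X_[_])%:P; apply/mnmP => j.
by rewrite mnmE !mnm1E.
Qed.

End UnivariateView.

Lemma mpoly_morph_eq n (R A : comNzRingType) (f g : {rmorphism {mpoly R[n]} -> A}) :
  (forall c, f c%:MP = g c%:MP) -> (forall i, f 'X_i = g 'X_i) -> f =1 g.
Proof.
move=> fgC fgX; elim/mpolyind => [|c k p _ _ IH]; first by rewrite !rmorph0.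
rewrite !rmorphD IH -mul_mpolyC !rmorphM fgC; congr (_ * _ + _).
rewrite mpolyXE_id !rmorph_prod; apply: eq_bigr => i _.
by rewrite !rmorphXn /= fgX.
Qed.

Lemma ord_widenP n (P : 'I_n.+1 -> Prop) :
  P ord_max -> (forall i : 'I_n, P (widen_ord (leqnSn n) i)) -> forall i, P i.
Proof.
move=> Pmax Pw i; have [ni|ni] := ltnP i n.
  by have -> : i = widen_ord (leqnSn n) (Ordinal ni) by apply/val_inj.
suff -> : i = ord_max by [].
by apply/val_inj/eqP; rewrite eqn_leq ni -ltnS ltn_ord.
Qed.

Lemma muniK n (R : comNzRingType) : cancel (@muni n R) (@unmuni n R).
Proof.
move=> p; apply: (@mpoly_morph_eq _ _ _ (unmuni n R \o @muni n R) idfun) => [c|i] /=.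
  by rewrite muniC unmuniC mwidenC.
elim/ord_widenP: i => [|i]; first by rewrite muniX_max unmuniX.
by rewrite muniX_widen unmuniC mwidenX mnmwiden1.
Qed.

Lemma unmuniK n (R : comNzRingType) : cancel (@unmuni n R) (@muni n R).
Proof.
have muni_mwiden (p : {mpoly R[n]}) : muni (mwiden p) = p%:P.
  apply: (@mpoly_morph_eq _ _ _ (@muni n R \o @mwiden n R) polyC) => [c|i] /=.
    by rewrite mwidenC muniC.
  by rewrite mwidenX mnmwiden1 muniX_widen.
elim/poly_ind => [|p c IH]; first by rewrite !rmorph0.
by rewrite !(rmorphD, rmorphM) /= IH unmuniX unmuniC muniX_max muni_mwiden.
Qed.

Theorem mpoly_primitive_parts n (K : fieldType) : has_primitive_parts {mpoly K[n]}.
Proof.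
elim: n => [|n IH].
  apply: (@iso_primitive_parts _ _ (mcoeff 0%MM) (@mpolyC 0 K)).
  - exact: mpolyKC.
  - exact: mpolyCK.
  - exact: field_primitive_parts.
apply: (iso_primitive_parts (@muniK n K) (@unmuniK n K)).
exact: poly_primitive_parts IH.
Qed.

(** * Evaluation, derivation and homogeneous components *)

Section Evaluation.

(** Used to compare operations that are compatible with sums and products. *)
Lemma mpoly_ring_ind n (R : comNzRingType) (P : {mpoly R[n]} -> Prop) :
  (forall c, P c%:MP) -> (forall i, P 'X_i) ->
  (forall p q, P p -> P q -> P (p + q)) ->
  (forall p q, P p -> P q -> P (p * q)) -> forall p, P p.
Proof.
move=> PC PX PD PM; elim/mpolyind => [|c m p _ _ Pp].
  by rewrite -mpolyC0.
apply: (PD) => //; rewrite -mul_mpolyC; apply: (PM) => //.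
rewrite mpolyXE_id; apply: big_ind => [|p1 p2|i _]; [by rewrite -mpolyC1|exact: PM|].
elim: (m i) => [|k IH]; first by rewrite expr0 -mpolyC1.
by rewrite exprS; apply: PM.
Qed.

Lemma meval_unmuni n (R : comNzRingType) (p : {poly {mpoly R[n]}}) (v : 'I_n.+1 -> R) :
  (unmuni n R p).@[v] =
  (map_poly (meval (fun i => v (widen_ord (leqnSn n) i))) p).[v ord_max].
Proof.
have meval_mwiden (q : {mpoly R[n]}) :
    (mwiden q).@[v] = q.@[fun i => v (widen_ord (leqnSn n) i)].
  apply: (@mpoly_morph_eq _ _ _ (meval v \o @mwiden n R)
    (meval (fun i => v (widen_ord (leqnSn n) i)))) => [c|i] /=.
    by rewrite mwidenC !mevalC.
  by rewrite mwidenX mnmwiden1 !mevalXU.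
elim/poly_ind: p => [|p c IH]; first by rewrite !rmorph0 horner0.
rewrite !(rmorphD, rmorphM) /= IH unmuniX unmuniC meval_mwiden mevalXU.
by rewrite map_polyX map_polyC hornerMXaddC.
Qed.

Lemma poly_eq0_eval (K : numDomainType) (p : {poly K}) : (forall x, p.[x] = 0) -> p = 0.
Proof.
move=> p0; apply/eqP/negP => /negP pN0.
pose rs : seq K := [seq i%:R | i <- iota 0 (size p)].
suff : (size rs < size p)%N by rewrite size_map size_iota ltnn.
apply: max_poly_roots pN0 _ _; first by apply/allP => x _; apply/eqP/p0.
by rewrite map_inj_uniq ?iota_uniq // => i j /eqP; rewrite eqr_nat => /eqP.
Qed.

Lemma mpoly_eq0_eval n (K : numDomainType) (p : {mpoly K[n]}) :
  (forall v, p.@[v] = 0) -> p = 0.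
Proof.
elim: n p => [|n IH] p p0.
  by have := p0 (fun=> 0); rewrite [p]nvar0_mpolyC mevalC => ->; rewrite mpolyC0.
rewrite -[p]muniK; have [-> | q0] := eqVneq (muni p) 0; first by rewrite rmorph0.
suff /eqP : lead_coef (muni p) = 0 by rewrite lead_coef_eq0 (negPf q0).
apply: IH => v.
have : map_poly (meval v) (muni p) = 0.
  apply: poly_eq0_eval => x.
  pose w (i : 'I_n.+1) := oapp (fun j : 'I_n => v j) x (insub (val i)).
  have := meval_unmuni (muni p) w; rewrite muniK p0 => E.
  have wmax : w ord_max = x by rewrite /w insubF //= ltnn.
  rewrite [RHS]E -wmax; congr (_.[_]); apply/eq_map_poly => q.
  by apply: meval_eq => i; rewrite /w [insub _](valK i).
by move/polyP/(_ (size (muni p)).-1); rewrite coef_map coef0.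
Qed.

Lemma mpoly_eq_eval n (K : numDomainType) (p q : {mpoly K[n]}) :
  (forall v, p.@[v] = q.@[v]) -> p = q.
Proof.
move=> pq; apply/eqP; rewrite -subr_eq0; apply/eqP/mpoly_eq0_eval => v.
by rewrite mevalB pq subrr.
Qed.

Lemma meval_homog n (R : comNzRingType) (p : {mpoly R[n]}) d (c : R) v :
  p \is d.-homog -> p.@[fun i => c * v i] = c ^+ d * p.@[v].
Proof.
move=> /dhomogP ph; rewrite !mevalE mulr_sumr !big_seq; apply: eq_bigr => m /ph /= <-.
rewrite mulrCA; congr (_ * _); rewrite mdegE -prodrXr -big_split /=.
by apply: eq_bigr => i _; rewrite exprMn.
Qed.

Lemma euler_homog n (R : comNzRingType) (p : {mpoly R[n]}) d :
  p \is d.-homog -> \sum_i 'X_i * p^`M(i) = p *+ d.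
Proof.
move=> /dhomogP ph; rewrite {2}(mpolyE p) -sumrMnl.
under eq_bigr => i _ do rewrite {1}(mpolyE p) raddf_sum mulr_sumr.
rewrite exchange_big /= !big_seq; apply: eq_bigr => m /ph /= <-.
rewrite mdegE -sumrMnr; apply: eq_bigr => i _.
rewrite mderivZ mderivX -scalerAr -scalerAr -mpolyXD; have [->|mi] := eqVneq (m i) 0%N.
  by rewrite mulr0n scale0r scaler0.
by rewrite addmC submK ?lep1mP // scaler_nat scalerMnr.
Qed.

Lemma mderivXU n (R : comNzRingType) (i j : 'I_n) :
  ('X_i : {mpoly R[n]})^`M(j) = (i == j)%:R.
Proof.
rewrite mderivX mnm1E; case: eqVneq => [->|_]; last by rewrite scale0r.
rewrite scale1r -mpolyX0; congr 'X_[_]; apply/mnmP => k.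
by rewrite mnmBE mnm0E subnn.
Qed.

Lemma mderiv_comp n k (R : comNzRingType) (f : n.-tuple {mpoly R[k]}) (p : {mpoly R[n]}) j :
  (p \mPo f)^`M(j) = \sum_i (p^`M(i) \mPo f) * (tnth f i)^`M(j).
Proof.
elim/mpoly_ring_ind: p => [c|i|p q IHp IHq|p q IHp IHq].
- rewrite comp_mpolyC mderivC big1 // => i _.
  by rewrite mderivC raddf0 mul0r.
- rewrite comp_mpolyXU (bigD1 i) //= big1 => [|l li].
    by rewrite mderivXU eqxx rmorph1 mul1r addr0 -tnth_nth.
  by rewrite mderivXU eq_sym (negPf li) rmorph0 mul0r.
- rewrite raddfD /= mderivD IHp IHq -big_split; apply: eq_bigr => i _ /=.
  by rewrite mderivD raddfD mulrDl.
rewrite rmorphM /= mderivM IHp IHq mulr_suml mulr_sumr -big_split.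
apply: eq_bigr => i _ /=; rewrite mderivM rmorphD !rmorphM /=; ring.
Qed.

Lemma comp_mpoly_homog n k (R : comNzRingType) (f : n.-tuple {mpoly R[k]})
    (p : {mpoly R[n]}) d e :
  (forall i, tnth f i \is d.-homog) -> p \is e.-homog -> p \mPo f \is (e * d).-homog.
Proof.
move=> fh /dhomogP ph; rewrite comp_mpolyEX big_seq; apply: rpred_sum => m /ph /= <-.
rewrite rpredZ // comp_mpolyX mdegE big_distrl /=.
apply: (big_rec2 (fun p k => p \is k.-homog)); first exact: dhomog1.
by move=> i q a _ qa; rewrite dhomogM // mulnC dhomogMn.
Qed.

Lemma msize_mderiv n (R : comNzRingType) (p : {mpoly R[n]}) i :
  p != 0 -> (msize p^`M(i) < msize p)%N.
Proof.
move=> p0; have [->|q0] := eqVneq p^`M(i) 0.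
  by rewrite msize0 lt0n msize_poly_eq0.
rewrite -mlead_deg //; set m := mlead _.
have : (m + U_(i))%MM \in msupp p.
  have : p^`M(i)@_m != 0 by rewrite mleadc_eq0.
  by rewrite mcoeff_mderiv mcoeff_msupp; apply: contraNneq => ->; rewrite mul0rn.
by move/msize_mdeg_lt; rewrite mdegD mdeg1 addn1.
Qed.

Lemma mderiv_eq0_const n (K : numDomainType) (p : {mpoly K[n]}) :
  (forall i, p^`M(i) = 0) -> p = (p@_0%MM)%:MP.
Proof.
move=> dp; apply/mpolyP => m; rewrite mcoeffC; have [->|m0] := eqVneq m 0%MM.
  by rewrite mulr1.
have [i mi] : exists i, m i != 0%N.
  apply: contrapT => nmi; case/eqP: m0; apply/mnmP => i; rewrite mnm0E.
  by apply: contrapT => /eqP mi; apply: nmi; exists i.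
rewrite mulr0; have := mcoeff_mderiv i p (m - U_(i))%MM.
rewrite dp mcoeff0 submK ?lep1mP // => /esym/eqP; rewrite mulrn_eq0 /=.
by move/eqP.
Qed.

(** Turns vanishing into divisibility: when [p \mPo g = 0], it shows that [p] lies
    in the ideal generated by the differences ['X_i - tnth g i]. *)
Lemma sub_comp_mpoly n (R : comNzRingType) (g : n.-tuple {mpoly R[n]}) (p : {mpoly R[n]}) :
  exists q : 'I_n -> {mpoly R[n]}, p - (p \mPo g) = \sum_i q i * ('X_i - tnth g i).
Proof.
elim/mpoly_ring_ind: p => [c|i|p q [a aE] [b bE]|p q [a aE] [b bE]].
- exists (fun=> 0); rewrite comp_mpolyC subrr big1 // => i _.
  by rewrite mul0r.
- exists (fun j => (i == j)%:R); rewrite comp_mpolyXU -tnth_nth (bigD1 i) //=.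
  rewrite eqxx mul1r big1 ?addr0 // => j ji; by rewrite eq_sym (negPf ji) mul0r.
- exists (fun i => a i + b i); rewrite rmorphD opprD addrACA aE bE -big_split.
  by apply: eq_bigr => i _; rewrite mulrDl.
exists (fun i => a i * q + (p \mPo g) * b i).
rewrite (eq_bigr (fun i => q * (a i * ('X_i - tnth g i)) +
  (p \mPo g) * (b i * ('X_i - tnth g i)))) => [|i _]; last by ring.
by rewrite big_split /= -!mulr_sumr -aE -bE rmorphM /=; ring.
Qed.

Section HomogeneousComponents.
Variables (n : nat) (R : comNzRingType).
Implicit Types p q : {mpoly R[n]}.

Lemma pihomogM p q d e : q \is d.-homog ->
  pihomog mdeg (e + d) (p * q) = pihomog mdeg e p * q.
Proof.
move=> qd; rewrite {1}(pihomog_partitionE (leqnn (msize p))) mulr_suml raddf_sum /=.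
have hom k : pihomog mdeg k p * q \is (k + d).-homog by rewrite dhomogM ?pihomogP.
have [em|me] := ltnP e (msize p).
  rewrite (bigD1 (Ordinal em)) //= big1 ?addr0 => [|k ke]; first exact: pihomog_dE.
  by apply: pihomog_ne0 (hom k); rewrite eqn_add2r.
rewrite big1 => [|k _]; last first.
  by apply: pihomog_ne0 (hom k); rewrite eqn_add2r ltn_eqF // (leq_trans _ me).
suff -> : pihomog mdeg e p = 0 by rewrite mul0r.
rewrite pihomogE big_seq_cond big1 // => m /andP[/msize_mdeg_lt mp /eqP me'].
by rewrite -me' leqNgt mp in me.
Qed.

Lemma pihomogM_lt p (b : {mpoly R[n]}) (q e : nat) : (q < e)%N -> b \is e.-homog ->
  pihomog mdeg q (p * b) = 0.
Proof.
move=> qe be; rewrite {1}(pihomog_partitionE (leqnn (msize p))) mulr_suml raddf_sum /=.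
have hom k : pihomog mdeg k p * b \is (k + e).-homog by rewrite dhomogM ?pihomogP.
rewrite big1 // => k _; apply: pihomog_ne0 (hom k).
by rewrite gtn_eqF // (leq_trans qe) ?leq_addl.
Qed.

Lemma msize_dhomog p d : p != 0 -> p \is d.-homog -> msize p = d.+1.
Proof.
move=> p0 pd; have pm := dhomog_msize pd.
by rewrite (dhomog_uniq p0 pd pm) prednK // lt0n msize_poly_eq0.
Qed.

End HomogeneousComponents.
End Evaluation.

(** * Zeros of binary forms *)

Lemma mpolyXU_neq0 n (R : nzRingType) (i : 'I_n) : 'X_i != 0 :> {mpoly R[n]}.
Proof. by rewrite -msize_poly_eq0 msizeX mdeg1. Qed.

Lemma ord2P (i : 'I_2) : i = ord0 \/ i = ord_max.
Proof. by case: i => [[|[|//]] ?]; [left|right]; apply/val_inj. Qed.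

Lemma ord2_neq_rev (i j : 'I_2) : i != rev_ord j -> i = j.
Proof. by move=> ij; apply/val_inj; case: i j ij => [[|[|//]] ?] [[|[|//]] ?]. Qed.

Section BinaryForms.
Variable K : numClosedFieldType.
Implicit Types p : {mpoly K[2]}.

(** The line through [u] is the common zero locus of the forms on the right, and
    a form that vanishes at [u] vanishes on that line. *)
Lemma homog_vanishing n (p : {mpoly K[n]}) d (u : 'I_n -> K) j :
  p \is d.-homog -> u j != 0 -> p.@[u] = 0 ->
  exists q : 'I_n -> {mpoly K[n]}, p = \sum_i q i * ('X_i - (u i / u j) *: 'X_j).
Proof.
move=> pd uj pu; pose g := [tuple (u i / u j) *: ('X_j : {mpoly K[n]}) | i < n].
have [q qE] := sub_comp_mpoly g p; exists q.
suff pg : p \mPo g = 0.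
  by move: qE; rewrite pg subr0 => ->; apply: eq_bigr => i _; rewrite tnth_mktuple.
apply: mpoly_eq0_eval => v; rewrite comp_mpoly_meval.
rewrite (@meval_eq _ _ _ (fun i => v j / u j * u i)) => [|i].
  by rewrite (meval_homog _ _ pd) pu mulr0.
by rewrite tnth_mktuple mevalZ mevalXU mulrAC [RHS]mulrC mulrA.
Qed.

(** A common zero of binary forms yields a common linear factor. *)
Lemma gcd_one_zeros k (f : k.-tuple {mpoly K[2]}) d (u : 'I_2 -> K) :
  gcd_is_one f -> (forall i, tnth f i \is d.-homog) -> (exists i, u i != 0) ->
  exists i, (tnth f i).@[u] != 0.
Proof.
move=> f_gcd fh [j uj]; apply: contrapT => nf.
pose j' := rev_ord j; pose l := 'X_j' - (u j' / u j) *: 'X_j : {mpoly K[2]}.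
have lu : l.@[u] = 0 by rewrite mevalB mevalZ !mevalXU divfK // subrr.
suff /f_gcd/unitrP[m [_ lm]] : forall i, mdivides l (tnth f i).
  have := congr1 (meval u) lm; rewrite mevalM lu mul0r meval1 => /eqP.
  by rewrite eq_sym oner_eq0.
move=> i; have fu : (tnth f i).@[u] = 0.
  by apply: contrapT => /eqP fu; apply: nf; exists i.
have [q ->] := homog_vanishing (fh i) uj fu.
exists (q j'); rewrite (bigD1 j') //= big1 ?addr0 // => m mj'.
suff -> : m = j by rewrite divff // scale1r subrr mulr0.
exact: ord2_neq_rev mj'.
Qed.

Definition affine_pt (t : K) (i : 'I_2) : K := if i == ord0 then t else 1.
Definition infinity_pt (i : 'I_2) : K := (i == ord0)%:R.

Lemma affine_pt_neq0 (t : K) : exists i, affine_pt t i != 0.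
Proof. by exists ord_max; rewrite /affine_pt /= oner_eq0. Qed.

Lemma infinity_pt_neq0 : exists i, infinity_pt i != 0.
Proof. by exists ord0; rewrite /infinity_pt oner_eq0. Qed.

(** Binary forms are studied through their restriction to the affine line
    [(t : 1)]; only the point at infinity [(1 : 0)] is lost. *)
Definition dehom : {rmorphism {mpoly K[2]} -> {poly K}} :=
  mmap polyC (fun i : 'I_2 => if i == ord0 then 'X else 1).

Lemma dehomC c : dehom c%:MP = c%:P.
Proof. exact: mmapC. Qed.

Lemma dehomXU i : dehom 'X_i = if i == ord0 then 'X else 1.
Proof. by rewrite /dehom /= mmapX mmap1U. Qed.

Lemma horner_dehom p t : (dehom p).[t] = p.@[affine_pt t].
Proof.
elim/mpoly_ring_ind: p => [c|i|p q IHp IHq|p q IHp IHq].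
- by rewrite dehomC hornerC mevalC.
- by rewrite dehomXU mevalXU /affine_pt; case: ifP; rewrite ?hornerX ?hornerC.
- by rewrite rmorphD hornerD IHp IHq mevalD.
- by rewrite rmorphM hornerM IHp IHq mevalM.
Qed.

Lemma deriv_dehom p : (dehom p)^`() = dehom p^`M(ord0).
Proof.
elim/mpoly_ring_ind: p => [c|i|p q IHp IHq|p q IHp IHq].
- by rewrite dehomC derivC mderivC rmorph0.
- by rewrite dehomXU mderivXU; case: eqP; rewrite ?derivX ?derivC ?rmorph1 ?rmorph0.
- by rewrite rmorphD derivD IHp IHq mderivD rmorphD.
- by rewrite rmorphM derivM IHp IHq mderivM rmorphD !rmorphM.
Qed.

Lemma dehomE p : dehom p = \sum_(m <- msupp p) p@_m *: 'X^(m ord0).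
Proof.
apply: eq_bigr => m _; rewrite mul_polyC; congr (_ *: _).
by rewrite /mmap1 big_ord_recl big_ord1 /= expr1n mulr1.
Qed.

(** The coefficient of degree [d] of the restriction is the value at infinity. *)
Lemma size_dehom p d : p \is d.-homog -> p.@[infinity_pt] != 0 -> size (dehom p) = d.+1.
Proof.
move=> /dhomogP pd pinf; have mE m : m \in msupp p -> d = (m ord0 + m (lift ord0 ord0))%N.
  by move/pd => /= <-; rewrite mdegE big_ord_recl big_ord1.
apply/eqP; rewrite eqn_leq; apply/andP; split.
  rewrite dehomE big_seq; apply: (leq_trans (size_sum _ _ _)).
  apply/bigmax_leqP_seq => m _ mp; rewrite (leq_trans (size_scale_leq _ _)) //.
  by rewrite size_polyXn ltnS (mE m mp) leq_addr.
suff pE : (dehom p)`_d = p.@[infinity_pt].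
  by rewrite ltnNge; apply: contra pinf => ?; rewrite -pE nth_default.
rewrite dehomE coef_sum mevalE !big_seq; apply: eq_bigr => m mp.
rewrite coefZ coefXn; congr (_ * _); rewrite big_ord_recl big_ord1 /infinity_pt /=.
rewrite expr1n mul1r expr0n (mE m mp) -[X in _ == X]addn0 eqn_add2l.
by [].
Qed.

Lemma dehom_eq0 p d : p \is d.-homog -> dehom p = 0 -> p = 0.
Proof.
move=> pd p0; suff : p * 'X_(lift ord0 ord0) = 0.
  by move/eqP; rewrite mulf_eq0 (negPf (mpolyXU_neq0 _ _)) orbF => /eqP.
apply: mpoly_eq0_eval => v; rewrite mevalM mevalXU.
set i1 := lift _ _; have [->|v1] := eqVneq (v i1) 0; first by rewrite mulr0.
rewrite (@meval_eq _ _ _ (fun i => v i1 * affine_pt (v ord0 / v i1) i)) => [|i].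
  by rewrite (meval_homog _ _ pd) -horner_dehom p0 horner0 mulr0 mul0r.
rewrite /affine_pt; case: ifP => [/eqP->|i0]; first by rewrite mulrC divfK.
by rewrite mulr1; congr v; apply/val_inj; case: i i0 => [[|[|//]] ?].
Qed.

Lemma binary_form_zero p d : p \is d.-homog -> (0 < d)%N ->
  exists u : 'I_2 -> K, (exists i, u i != 0) /\ p.@[u] = 0.
Proof.
move=> pd d0; have [pinf|pinf] := eqVneq p.@[infinity_pt] 0.
  by exists infinity_pt; split=> //; exists ord0; rewrite /infinity_pt eqxx oner_eq0.
have /closed_rootP[t /rootP pt] : size (dehom p) != 1%N.
  by rewrite (size_dehom pd pinf) eqSS -lt0n.
exists (affine_pt t); split; last by rewrite -horner_dehom.
by exists (lift ord0 ord0); rewrite /affine_pt /= oner_eq0.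
Qed.

(** If both partial derivatives do not vanish simultaneously at a zero then, by
    Euler's relation, the derivative along the affine line does not vanish
    there.  Hence the restriction to that line is separable. *)
Lemma simple_zeros p d : p \is d.-homog -> p.@[infinity_pt] != 0 ->
  (forall t, p.@[affine_pt t] = 0 -> exists i, p^`M(i).@[affine_pt t] != 0) ->
  exists ts : seq K, [/\ uniq ts, size ts = d & forall t, t \in ts -> p.@[affine_pt t] = 0].
Proof.
move=> pd pinf simp; have sp := size_dehom pd pinf.
have p0 : dehom p != 0 by rewrite -size_poly_eq0 sp.
have [ts tsE] := closed_field_poly_normal (dehom p).
have lp : lead_coef (dehom p) != 0 by rewrite lead_coef_eq0.
have rts t : (t \in ts) = (p.@[affine_pt t] == 0).
  by rewrite -horner_dehom -[_ == 0]/(root _ _) tsE rootZ // root_prod_XsubC.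
exists ts; split; last by move=> t; rewrite rts => /eqP.
  rewrite -separable_prod_XsubC.
  apply: (@dvdp_separable _ (dehom p)); first by rewrite [X in _ %| X]tsE dvdpZr.
  rewrite unlock deriv_dehom.
  apply: Pdiv.ClosedField.root_coprimep => t /rootP; rewrite !horner_dehom => pt.
  have [i dpi] := simp t pt; apply: contraNneq dpi => p0t.
  have [->|i0] := eqVneq i ord0; first by rewrite p0t.
  have := congr1 (meval (affine_pt t)) (euler_homog pd).
  rewrite mevalMn pt mul0rn big_ord_recl big_ord1 mevalD !mevalM p0t mulr0 add0r.
  rewrite mevalXU /affine_pt /= mul1r => <-; apply/eqP; congr (_ ^`M(_)).@[_].
  by apply/val_inj; case: i i0 => [[|[|//]] ?].
have := sp; rewrite {1}tsE size_scale // size_prod_XsubC => -[].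
by [].
Qed.

End BinaryForms.

(** * The kernel of a parametrization *)

Section Jacobian.
Variables (K : numFieldType) (n : nat) (I : finType) (f : I -> {mpoly K[n]}).

(** Write [f = g c] with [c] primitive.  The derivative of [c] is proportional to
    [c], so a multiple of it, and this multiple is zero by degree: [c] is
    constant. *)
Lemma proportional_mderiv :
  (forall i j k, (f i)^`M(k) * f j = f i * (f j)^`M(k)) ->
  exists g c, forall i, f i = c i *: g.
Proof.
move=> wf; have [g [c [prim_c fE]]] := mpoly_primitive_parts f.
have [[i0 fi0]|f0] := EM (exists i, f i != 0); last first.
  exists 0, (fun=> 0) => i; rewrite scaler0; apply: contrapT => /eqP fi.
  by apply: f0; exists i.
have g0 : g != 0 by apply: contraNneq fi0; rewrite fE => ->; rewrite mul0r.
have ci0 : c i0 != 0 by apply: contraNneq fi0; rewrite fE => ->; rewrite mulr0.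
(* The terms with a derivative of [g] cancel. *)
have wc i j k : (c i)^`M(k) * c j = c i * (c j)^`M(k).
  apply: (mulfI g0); apply: (mulfI g0); have := wf i j k.
  rewrite !fE !mderivM => /eqP; rewrite -subr_eq0 => /eqP E.
  by apply/eqP; rewrite -subr_eq0 -[X in _ == X]E; apply/eqP; ring.
have dc k j : (c j)^`M(k) = 0.
  have [h hE] := prim_c (c i0) (c i0)^`M(k) (fun j => (c j)^`M(k)) ci0
    (fun j => esym (wc i0 j k)).
  rewrite hE; suff -> : h = 0 by rewrite mul0r.
  apply: contrapT => /eqP h0; have := msize_mderiv k ci0.
  rewrite hE msizeM // -(prednK (_ : 0 < msize h)%N) ?lt0n ?msize_poly_eq0 //.
  by rewrite addSn /= ltnNge leq_addl.
exists g, (fun i => (c i)@_0%MM) => i.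
by rewrite fE mulrC -mul_mpolyC -mderiv_eq0_const.
Qed.

(** By Euler's relation the vanishing of the minors of the Jacobian matrix makes
    the vector of forms proportional to each of its derivatives. *)
Lemma jacobian_eq0 d : (0 < d)%N -> (forall i, f i \is d.-homog) ->
  (forall i j k l, (f i)^`M(k) * (f j)^`M(l) = (f i)^`M(l) * (f j)^`M(k)) ->
  exists g c, forall i, f i = c i *: g.
Proof.
move=> d0 fh jf; apply: proportional_mderiv => i j k.
apply: (@mulIf _ (d%:R%:MP)); first by rewrite mpolyC_eq0 pnatr_eq0 -lt0n.
have E (p : {mpoly K[n]}) : p \is d.-homog -> p * d%:R%:MP = \sum_i 'X_i * p^`M(i).
  by move=> ph; rewrite (euler_homog ph) mulrC mul_mpolyC scaler_nat.
rewrite -mulrA E // [RHS]mulrAC E // mulr_sumr mulr_suml; apply: eq_bigr => l _.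
by rewrite mulrCA jf mulrA.
Qed.

End Jacobian.

Lemma mderiv_dhomog n (R : comNzRingType) (p : {mpoly R[n]}) d i :
  p \is d.-homog -> p^`M(i) \is d.-1.-homog.
Proof.
move=> /dhomogP pd; rewrite [p]mpolyE raddf_sum big_seq rpred_sum //= => m /pd /= mp.
rewrite mderivZ mderivX scalerA; have [->|mi] := eqVneq (m i) 0%N.
  by rewrite mulr0 scale0r rpred0.
by rewrite rpredZ // dhomogX -mp -{2}(@submK _ U_(i)%MM m) ?lep1mP // mdegD mdeg1 addn1.
Qed.

(** Seen as a polynomial in its last variable, a form of degree [e] has constant
    coefficient in degree [e], namely its value at the last coordinate point. *)
Lemma size_muni n (R : comNzRingType) (F : {mpoly R[n.+1]}) e :
  F \is e.-homog -> (size (muni F) <= e.+1)%N /\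
  (muni F)`_e = (F.@[fun i => (i == ord_max)%:R])%:MP.
Proof.
move=> /dhomogP Fe; have mE m : m \in msupp F ->
    e = (\sum_(i < n) m (widen_ord (leqnSn n) i) + m ord_max)%N.
  by move/Fe => /= <-; rewrite mdegE big_ord_recr.
rewrite muniE; split.
  rewrite big_seq; apply: (leq_trans (size_sum _ _ _)).
  apply/bigmax_leqP_seq => m _ mF; rewrite (leq_trans (size_scale_leq _ _)) //.
  by rewrite size_polyXn ltnS (mE m mF) leq_addl.
rewrite coef_sum mevalE raddf_sum /= !big_seq; apply: eq_bigr => m mF.
rewrite coefZ coefXn big_ord_recr /= eqxx expr1n mulr1.
rewrite [X in _ = (_ * X)%:MP](_ : _ = 0 ^+ \sum_(i < n) m (widen_ord (leqnSn n) i)); last first.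
  rewrite -prodrXr; apply: eq_bigr => i _; congr (_ ^+ _).
  by rewrite (_ : _ == _ = false) //; apply/eqP => /(congr1 val) /= /eqP; rewrite ltn_eqF.
rewrite expr0n {1}(mE m mF) -[X in _ == X]add0n eqn_add2r.
case: eqP => [s0|_]; last by rewrite !mulr0 mpolyC0.
rewrite !mulr1; set m' := [multinom _ | _ < _]; suff -> : m' = 0%MM.
  by rewrite mpolyX0 -mul_mpolyC mulr1.
by apply/eqP; rewrite -mdeg_eq0 mdegE; apply/eqP; rewrite -[RHS]s0; apply: eq_bigr => i _; rewrite mnmE.
Qed.

Lemma linear_form_neq0 (K : numFieldType) (a b : K) : a != 0 \/ b != 0 ->
  a *: 'X_ord_max - b *: 'X_ord0 != 0 :> {mpoly K[2]}.
Proof.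
move=> ab; apply/eqP => l0.
have := congr1 (meval (fun i : 'I_2 => (i == ord_max)%:R)) l0.
have := congr1 (meval (fun i : 'I_2 => (i == ord0)%:R)) l0.
rewrite !mevalB !mevalZ !mevalXU !meval0 /= !mulr1 !mulr0 sub0r subr0.
by move=> /eqP; rewrite oppr_eq0 => /eqP b0 a0; case: ab; rewrite ?a0 ?b0 eqxx.
Qed.

Section Kernel.
Variables (K : numClosedFieldType) (d : nat).
Hypothesis d_gt0 : (0 < d)%N.

Section BinaryPencil.
Variables (f : 3.-tuple {mpoly K[2]}).
Hypothesis f_homog : forall i, tnth f i \is d.-homog.
Let i0 : 'I_3 := widen_ord (leqnSn 2) ord0.
Let i1 : 'I_3 := widen_ord (leqnSn 2) ord_max.
Let f0 := tnth f i0.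
Let f1 := tnth f i1.
Let f2 := tnth f ord_max.
Hypothesis f01 : forall u : 'I_2 -> K, (exists i, u i != 0) -> f0.@[u] != 0 \/ f1.@[u] != 0.

Definition wronskian (p q : {mpoly K[2]}) := p^`M(ord0) * q^`M(ord_max) - p^`M(ord_max) * q^`M(ord0).

(** Otherwise [f0] and [f1] are constant multiples of one form, which has a zero;
    that zero would be common to both. *)
Lemma wronskian_neq0 : wronskian f0 f1 != 0.
Proof.
apply/eqP => W0.
have [||g [c fE]] := @jacobian_eq0 _ _ _ (fun b : bool => if b then f0 else f1) d d_gt0.
- by case; apply: f_homog.
- move/eqP: W0; rewrite subr_eq0 => /eqP W0.
  have W k l : f0^`M(k) * f1^`M(l) = f0^`M(l) * f1^`M(k).
    by case: (ord2P k) => ->; case: (ord2P l) => ->.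
  move=> [] [] k l //=; first by rewrite mulrC.
    by rewrite mulrC -W mulrC.
  by rewrite mulrC.
have f0E := fE true; have f1E := fE false; rewrite /= in f0E f1E.
suff [u [u0 [fu0 fu1]]] : exists u : 'I_2 -> K, (exists i, u i != 0) /\ f0.@[u] = 0 /\ f1.@[u] = 0.
  by case: (f01 u0) => /eqP.
have [c0|c0] := eqVneq (c true) 0.
  have [u [u0 fu]] := binary_form_zero (f_homog i1) d_gt0.
  by exists u; split=> //; split=> //; rewrite f0E c0 scale0r meval0.
have [u [u0 fu]] := binary_form_zero (f_homog i0) d_gt0.
exists u; split=> //; split=> //; rewrite f1E mevalZ.
have /eqP := fu; rewrite -/f0 f0E mevalZ mulf_eq0 (negPf c0) => /eqP ->.
by rewrite mulr0.
Qed.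

Section Monic.
Variables (F P : {mpoly K[3]}).
Hypothesis f_inj : generically_injective f.
Hypothesis F_homog : F \is d.-homog.
Hypothesis F_vertex : F.@[fun i => (i == ord_max)%:R] != 0.
Hypothesis Ff : F \mPo f = 0.
Hypothesis Pf : P \mPo f = 0.

(** The zeros of the pencil member [v_1 f0 - v_0 f1] are the points whose image
    under [(f0, f1)] is proportional to [v]; extracting a [d]-th root rescales
    such a point so that its image is [v] itself. *)
Lemma fibre_point (v : 'I_2 -> K) t : (exists i, v i != 0) ->
  v ord_max * f0.@[affine_pt t] = v ord0 * f1.@[affine_pt t] ->
  exists w : K, [/\ w != 0, f0.@[fun i => w * affine_pt t i] = v ord0 &
    f1.@[fun i => w * affine_pt t i] = v ord_max].
Proof.
move=> v0; set a := f0.@[_]; set b := f1.@[_] => vE.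
have [mu ma mb] : exists2 mu, mu * a = v ord0 & mu * b = v ord_max.
  have [a0|b0] := f01 (affine_pt_neq0 t).
    by exists (v ord0 / a); rewrite ?divfK // mulrAC -vE mulfK.
  by exists (v ord_max / b); rewrite ?divfK // mulrAC vE mulfK.
have mu0 : mu != 0.
  apply: contraTneq isT => mu0; case: v0 => i /eqP[].
  have [->|->] := ord2P i.
    by rewrite -ma mu0 mul0r.
  by rewrite -mb mu0 mul0r.
exists (d.-root mu); rewrite rootC_eq0 // mu0; split=> //.
  by rewrite (meval_homog _ _ (f_homog i0)) rootCK.
by rewrite (meval_homog _ _ (f_homog i1)) rootCK.
Qed.

(** Over a general point [v] of the plane of the first two coordinates the cone
    over the curve has [d] distinct points.  Indeed the binary form
    [v_1 f0 - v_0 f1] has degree [d], and all its zeros are simple and have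
    distinct images as soon as none of them is a zero of the Wronskian or of the
    form that witnesses generic injectivity.  [T] is the product of the linear
    forms in [v] that express these finitely many conditions. *)
Lemma general_line : exists2 T : {mpoly K[2]}, T != 0 &
  forall v : 'I_2 -> K, T.@[v] != 0 -> exists zs : seq K,
    [/\ uniq zs, size zs = d & forall z, z \in zs -> exists u : 'I_2 -> K,
      [/\ f0.@[u] = v ord0, f1.@[u] = v ord_max & f2.@[u] = z]].
Proof.
have [e [G [Gh [u0 _ Gu0] Ginj]]] := f_inj.
pose g := G \mPo f; have gh : g \is (e * d).-homog by apply: comp_mpoly_homog.
have gE u : g.@[u] = G.@[fun i => (tnth f i).@[u]] by rewrite comp_mpoly_meval.
have GE (u : 'rV[K]_2) : G.@[eval_map f u 0] = g.@[u 0].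
  by rewrite gE; apply: meval_eq => i; rewrite mxE.
have g0 : g != 0 by apply: contraNneq Gu0 => g0; rewrite GE g0 meval0.
pose W := wronskian f0 f1; have W0 := wronskian_neq0; rewrite -/W in W0.
have Wh : W \is (d.-1 + d.-1).-homog.
  by rewrite rpredB ?dhomogM ?mderiv_dhomog ?f_homog.
pose Phi := W * g; have Phi0 : Phi != 0 by rewrite mulf_neq0.
have Phih : Phi \is (d.-1 + d.-1 + e * d).-homog by rewrite dhomogM.
have dPhi0 : dehom K Phi != 0 by apply: contraNneq Phi0 => /(dehom_eq0 Phih) ->.
have [rs rsE] := closed_field_poly_normal (dehom K Phi).
have rsP t : Phi.@[affine_pt t] = 0 -> t \in rs.
  rewrite -horner_dehom => /rootP; rewrite rsE rootZ ?lead_coef_eq0 //.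
  by rewrite root_prod_XsubC.
(* [L u] vanishes at [v] exactly when [u] is a zero of the pencil member of [v]. *)
pose L (u : 'I_2 -> K) := f0.@[u] *: 'X_ord_max - f1.@[u] *: 'X_ord0 : {mpoly K[2]}.
have L0 u : (exists i, u i != 0) -> L u != 0.
  by move=> /f01 f01u; apply: linear_form_neq0.
have LE u v : (L u).@[v] = (v ord_max *: f0 - v ord0 *: f1).@[u].
  by rewrite !mevalB !mevalZ !mevalXU mulrC [X in _ - X]mulrC.
exists (L (infinity_pt K) * \prod_(t <- rs) L (affine_pt t)) => [|v].
  rewrite mulf_neq0 ?L0 //; first exact: infinity_pt_neq0.
  by rewrite prodf_seq_neq0; apply/allP => t _; apply/L0/affine_pt_neq0.
rewrite mevalM mulf_eq0 negb_or rmorph_prod /= prodf_seq_neq0 => /andP[Linf /allP Lrs].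
have v0 : exists i, v i != 0.
  apply: contrapT => nv; have {}nv i : v i = 0 by apply: contrapT => /eqP vi; apply: nv; exists i.
  by case/eqP: Linf; rewrite LE !nv !scale0r subrr meval0.
pose b := v ord_max *: f0 - v ord0 *: f1.
have bh : b \is d.-homog by rewrite rpredB ?rpredZ ?f_homog.
rewrite LE -/b in Linf.
have good t : b.@[affine_pt t] = 0 -> Phi.@[affine_pt t] != 0.
  move=> bt; apply/negP => /eqP /rsP /Lrs /=.
  by rewrite LE -/b bt eqxx.
have [t bt|ts [uts sts tsP]] := simple_zeros bh Linf.
  apply: contrapT => nb; have {}nb k : v ord_max * (f0^`M(k)).@[affine_pt t] =
      v ord0 * (f1^`M(k)).@[affine_pt t].
    apply/eqP; rewrite -subr_eq0; apply: contrapT => bk; apply: nb; exists k.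
    by rewrite mderivB !mderivZ mevalB !mevalZ; apply/negP.
  (* At a multiple zero [v] is a linear relation between the gradients of [f0] and [f1]. *)
  have vW i : v i * W.@[affine_pt t] = 0.
    rewrite /W /wronskian mevalB !mevalM mulrBr.
    have [->|->] := ord2P i.
      by rewrite !(mulrCA (v ord0)) -!nb; ring.
    by rewrite !(mulrA (v ord_max)) !nb; ring.
  have := good t bt; rewrite mevalM mulf_eq0 negb_or => /andP[Wt _].
  by case: v0 => i; have /eqP := vW i; rewrite mulf_eq0 (negPf Wt) orbF => ->.
have wP t : exists w : K, t \in ts -> [/\ w != 0, f0.@[fun i => w * affine_pt t i] = v ord0 &
    f1.@[fun i => w * affine_pt t i] = v ord_max].
  have [tts|_] := boolP (t \in ts); last by exists 0.
  have [|w wE] := @fibre_point v t v0; last by exists w.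
  by apply/eqP; rewrite -subr_eq0 -!mevalZ -mevalB tsP.
have [w {}wP] := choice wP.
pose u t : 'I_2 -> K := fun i => w t * affine_pt t i.
exists [seq f2.@[u t] | t <- ts]; split; last first.
- move=> z /mapP[t tts ->]; exists (u t); by have [] := wP t tts.
- by rewrite size_map.
rewrite map_inj_in_uniq // => t t' tts t'ts ztt'.
have [wt0 ut0 ut1] := wP t tts; have [wt'0 ut'0 ut'1] := wP t' t'ts.
pose U t : 'rV[K]_2 := \row_i u t i.
have UE s : U s 0 =1 u s by move=> i; rewrite mxE.
have U0 s : w s != 0 -> U s != 0.
  move=> ws; apply/eqP => /rowP /(_ ord_max); rewrite !mxE /u /affine_pt /= mulr1.
  exact/eqP.
have fU : eval_map f (U t) = eval_map f (U t').
  apply/rowP => i; rewrite !mxE !(meval_eq _ (UE _)).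
  elim/ord_widenP: i => [|i]; first exact: ztt'.
  have [->|->] := ord2P i; first by rewrite [LHS]ut0 [RHS]ut'0.
  by rewrite [LHS]ut1 [RHS]ut'1.
have [||c c0 /rowP UE'] := Ginj (U t) (U t') (U0 t wt0) (U0 t' wt'0).
- rewrite GE (meval_eq _ (UE _)) (meval_homog _ _ gh) mulf_neq0 ?expf_neq0 //.
  by have := good t (tsP t tts); rewrite mevalM mulf_eq0 negb_or => /andP[].
- by exists 1; rewrite ?oner_neq0 // scale1r fU.
have := UE' ord0; have := UE' ord_max; rewrite !mxE /u /affine_pt /= !mulr1 => -> E.
by apply/esym/(mulfI wt0)/(mulfI c0); rewrite mulrA E.
Qed.

(** Over a general point [r] has more roots than its degree allows. *)
Lemma remainder_eq0 (r : {poly {mpoly K[2]}}) :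
  (size r <= d)%N -> unmuni 2 K r \mPo f = 0 -> r = 0.
Proof.
have [T T0 TP] := general_line; move=> sr rf; apply/polyP => j; rewrite coef0.
suff /eqP : r`_j * T = 0 by rewrite mulf_eq0 (negPf T0) orbF => /eqP.
apply: mpoly_eq0_eval => v; rewrite mevalM.
have [->|/TP[zs [uzs szs zsP]]] := eqVneq T.@[v] 0; first by rewrite mulr0.
suff /polyP/(_ j) : map_poly (meval v) r = 0 by rewrite coef_map coef0 => ->; rewrite mul0r.
apply: contrapT => /eqP rv0; suff : (size zs < size (map_poly (meval v) r))%N.
  by rewrite ltnNge szs (leq_trans (size_poly _ _)).
apply: (max_poly_roots rv0) => //; apply/allP => z /zsP[u [u0 u1 uz]].
pose x (i : 'I_3) := (tnth f i).@[u].
have := congr1 (meval u) rf; rewrite comp_mpoly_meval meval0 => E.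
apply/rootP; rewrite -uz -E meval_unmuni; congr (_.[_]); apply/eq_map_poly => p.
apply: meval_eq => i; have [->|->] := ord2P i; first by rewrite u0.
by rewrite u1.
Qed.

Lemma kernel_monic : mdivides F P.
Proof.
pose c := F.@[fun i => (i == ord_max)%:R]; have c0 : c != 0 := F_vertex.
have [sF cF] := size_muni F_homog; rewrite -/c in cF.
have sF' : size (muni F) = d.+1.
  apply/eqP; rewrite eqn_leq sF ltnNge; apply: contra c0 => sd.
  by rewrite -(mpolyC_eq0 2) -[c%:MP_[_]]cF nth_default.
pose F1 := c^-1 *: F; have monF1 : muni F1 \is monic.
  rewrite monicE muniZ -mul_polyC lead_coefM lead_coefC /lead_coef sF' cF.
  by rewrite -mpolyCM mulVf.
have PE := Pdiv.RingMonic.rdivp_eq monF1 (muni P).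
pose q := Pdiv.Ring.rdivp (muni P) (muni F1); pose r := Pdiv.Ring.rmodp (muni P) (muni F1).
have {}PE : P = unmuni 2 K q * F1 + unmuni 2 K r.
  by rewrite -[LHS]muniK PE rmorphD rmorphM /= muniK.
suff r0 : r = 0.
  exists (unmuni 2 K q * (c^-1)%:MP); rewrite {1}PE r0 rmorph0 addr0.
  by rewrite /F1 -mul_mpolyC mulrA.
apply: remainder_eq0.
  have : (size r < size (muni F1))%N by rewrite Pdiv.Ring.ltn_rmodpN0 ?monic_neq0.
  by rewrite muniZ -mul_polyC mul_polyC size_scale ?mpolyC_eq0 ?invr_eq0 // sF' ltnS.
have := Pf; rewrite PE rmorphD rmorphM /= /F1 linearZ /= Ff.
by rewrite scaler0 mulr0 add0r.
Qed.

End Monic.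

End BinaryPencil.

Definition linear_map n (B : 'M[K]_n) : n.-tuple {mpoly K[n]} :=
  [tuple \sum_i B i j *: 'X_i | j < n].

Lemma meval_linear_map n (B : 'M[K]_n) (p : {mpoly K[n]}) v :
  (p \mPo linear_map B).@[v] = p.@[((\row_i v i) *m B) 0].
Proof.
rewrite comp_mpoly_meval; apply: meval_eq => j; rewrite tnth_mktuple.
rewrite raddf_sum /= !mxE; apply: eq_bigr => i _.
by rewrite mevalZ mevalXU mxE mulrC.
Qed.

Lemma linear_map_homog n (B : 'M[K]_n) i : tnth (linear_map B) i \is 1.-homog.
Proof.
by rewrite tnth_mktuple rpred_sum // => j _; rewrite rpredZ // dhomogX; apply/eqP/mdeg1.
Qed.

(** Only the line spanned by [w] matters: a form does not vanish at [w] if and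
    only if it does not vanish at the last vector of the frame. *)
Lemma exists_frame (w : 'rV[K]_3) : w != 0 ->
  exists2 B : 'M[K]_3, B \in unitmx & exists2 c, c != 0 & w = c *: row ord_max B.
Proof.
move=> w0; exists (xrow 0 ord_max (row_ebase w)).
  by rewrite xrowE unitmx_mul row_ebase_unit unitmx_perm.
have rw : \rank w = 1%N by apply/eqP; rewrite rank_rV w0.
pose c := col_ebase w 0 0; have wE : w = c *: row 0 (row_ebase w).
  rewrite -{1}(mulmx_ebase w) rw [col_ebase w]mx11_scalar mul_scalar_mx -scalemxAl.
  congr (_ *: _); apply/rowP => j; rewrite !mxE (bigD1 0) //= big1 => [|i i0].
    by rewrite mxE mul1r addr0.
  by case: i i0 => [[|i] hi] //= _; rewrite mxE /= mul0r.
exists c; first by apply: contraNneq w0 => c0; rewrite wE c0 scale0r.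
rewrite [LHS]wE; congr (_ *: _); apply/rowP => j; by rewrite !mxE tpermR.
Qed.

(** A change of coordinates moves a point off the curve to [(0 : 0 : 1)].  The
    projection from this point has no base point on the curve, and [F] becomes
    monic in the last variable, so that division by [F] is possible. *)
Theorem parametrization_kernel (f : 3.-tuple {mpoly K[2]}) (F P : {mpoly K[3]}) :
  (forall i, tnth f i \is d.-homog) -> gcd_is_one f -> generically_injective f ->
  F \is d.-homog -> F != 0 -> F \mPo f = 0 -> P \mPo f = 0 -> mdivides F P.
Proof.
move=> fh f_gcd f_inj Fh F0 Ff Pf.
have [w Fw] : exists w : 'rV[K]_3, F.@[w 0] != 0.
  apply: contrapT => nF; case/eqP: F0; apply: mpoly_eq0_eval => v.
  apply: contrapT => /eqP Fv; apply: nF; exists (\row_i v i).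
  by rewrite (meval_eq _ (_ : _ =1 v)) // => i; rewrite mxE.
have w0 : w != 0.
  apply: contraNneq Fw => ->; rewrite (@meval_eq _ _ _ (fun i => 0 * (fun=> 0) i)) => [|i].
    by rewrite (meval_homog _ _ Fh) expr0n gtn_eqF // mul0r.
  by rewrite mxE mul0r.
have [B uB [c c0 wE]] := exists_frame w0.
pose f' := [tuple tnth (linear_map (invmx B)) j \mPo f | j < 3].
have f'E u : eval_map f' u = eval_map f u *m invmx B.
  apply/rowP => j; rewrite !mxE tnth_mktuple comp_mpoly_meval tnth_mktuple raddf_sum /=.
  by apply: eq_bigr => i _; rewrite mevalZ mevalXU mxE mulrC.
have compB (p : {mpoly K[3]}) : (p \mPo linear_map B) \mPo f' = p \mPo f.
  apply: mpoly_eq_eval => v; rewrite comp_mpoly_meval meval_linear_map comp_mpoly_meval.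
  apply: meval_eq => j.
  rewrite (_ : \row_i _ = eval_map f' (\row_i v i)); last first.
    by apply/rowP => i; rewrite !mxE; apply: meval_eq => k; rewrite mxE.
  by rewrite f'E mulmxKV // mxE; apply: meval_eq => k; rewrite mxE.
have invB (p : {mpoly K[3]}) : (p \mPo linear_map B) \mPo linear_map (invmx B) = p.
  apply: mpoly_eq_eval => v; rewrite !meval_linear_map.
  apply: meval_eq => j; rewrite (_ : \row_i _ = (\row_i v i) *m invmx B).
    by rewrite mulmxKV // mxE.
  by apply/rowP => i; rewrite !mxE.
suff [H HE] : mdivides (F \mPo linear_map B) (P \mPo linear_map B).
  exists (H \mPo linear_map (invmx B)).
  by rewrite -[LHS]invB HE rmorphM /= invB.
have f'h i : tnth f' i \is d.-homog.
  rewrite tnth_mktuple -[d]mul1n; apply: comp_mpoly_homog => //.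
  exact: linear_map_homog.
have vertex : (F \mPo linear_map B).@[fun i => (i == ord_max)%:R] != 0.
  apply: contraNneq Fw; rewrite meval_linear_map => FB; rewrite wE.
  rewrite (@meval_eq _ _ _ (fun i => c * (row ord_max B) 0 i)) => [|i]; last by rewrite mxE.
  rewrite (meval_homog _ _ Fh) -[X in _ * X](_ : F.@[(\row_i (i == ord_max)%:R *m B) 0] = _).
    by rewrite FB mulr0.
  apply: meval_eq => j; rewrite rowE; congr ((_ *m _) _ _).
  by apply/rowP => i; rewrite !mxE eqxx.
have FBh : F \mPo linear_map B \is d.-homog.
  by rewrite -[d]muln1; apply: comp_mpoly_homog => // i; apply: linear_map_homog.
apply: (@kernel_monic f') => //.
- move=> u u0; apply: contrapT => nfu.
  have fu (j : 'I_2) : (tnth f' (widen_ord (leqnSn 2) j)).@[u] = 0.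
    apply: contrapT => /eqP fj; apply: nfu.
    by have [jE|jE] := ord2P j; [left|right]; rewrite -jE.
  have ftop i : (tnth f' i).@[u] = (tnth f' ord_max).@[u] * (i == ord_max)%:R.
    elim/ord_widenP: i => [|j]; first by rewrite eqxx mulr1.
    rewrite fu (_ : _ == _ = false) ?mulr0 //.
    by apply/eqP => /(congr1 val) /= /eqP; rewrite ltn_eqF.
  have z0 : (tnth f' ord_max).@[u] = 0.
    have := congr1 (meval u) (compB F); rewrite Ff meval0 comp_mpoly_meval (meval_eq _ ftop).
    rewrite (meval_homog _ _ FBh) => /eqP; rewrite mulf_eq0 (negPf vertex) orbF.
    by rewrite expf_eq0 d_gt0 => /eqP.
  have [i /negP] := gcd_one_zeros f_gcd fh u0; case; apply/eqP.
  rewrite -[tnth f i](_ : 'X_i \mPo f = _); last by rewrite comp_mpolyXU -tnth_nth.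
  rewrite -compB comp_mpoly_meval (meval_eq _ ftop) z0 (meval_homog _ _ (_ : _ \is 1.-homog)).
    by rewrite expr1 mul0r.
  by rewrite comp_mpolyXU -tnth_nth linear_map_homog.
- have [e [G [Gh [u u0 Gu] Ginj]]] := f_inj.
  have GE v : (G \mPo linear_map B).@[eval_map f' v 0] = G.@[eval_map f v 0].
    rewrite meval_linear_map f'E (_ : \row_i _ = eval_map f v *m invmx B) ?mulmxKV //.
    by apply/rowP => i; rewrite mxE.
  exists e, (G \mPo linear_map B); split.
  + by rewrite -[e]muln1; apply: comp_mpoly_homog => // i; apply: linear_map_homog.
  + by exists u; rewrite ?GE.
  + move=> v1 v2 v10 v20; rewrite GE => Gv [k k0 vE]; apply: Ginj => //; exists k => //.
    move: vE; rewrite !f'E => /(congr1 (mulmx^~ B)).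
    by rewrite mulmxKV // -scalemxAl mulmxKV.
- by rewrite compB.
- by rewrite compB.
Qed.

End Kernel.

(** * The gradient of a prime form *)

Section PrimeForm.
Variables (K : numFieldType) (n : nat) (F : {mpoly K[n]}) (d : nat).
Hypothesis d_gt0 : (0 < d)%N.
Hypothesis F_homog : F \is d.-homog.
Hypothesis F_neq0 : F != 0.
Hypothesis F_prime : forall p q, mdivides F (p * q) -> mdivides F p \/ mdivides F q.

Lemma natC_neq0 : (d%:R%:MP : {mpoly K[n]}) != 0.
Proof. by rewrite mpolyC_eq0 pnatr_eq0 -lt0n. Qed.

Lemma eulerF : F * d%:R%:MP = \sum_i 'X_i * F^`M(i).
Proof. by rewrite (euler_homog F_homog) mulrC mul_mpolyC scaler_nat. Qed.

Lemma exists_mderiv_neq0 : exists i, F^`M(i) != 0.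
Proof.
apply: contrapT => nF; case/eqP: F_neq0; apply: (mulIf natC_neq0).
rewrite mul0r eulerF big1 // => i _; rewrite [F^`M(i)](_ : _ = 0) ?mulr0 //.
by apply: contrapT => /eqP Fi; apply: nF; exists i.
Qed.

Lemma not_mdivides_mderiv i : F^`M(i) != 0 -> ~ mdivides F F^`M(i).
Proof.
move=> Fi [h hE]; have h0 : h != 0 by apply: contraNneq Fi => h0; rewrite hE h0 mul0r.
have := msize_mderiv i F_neq0; rewrite hE msizeM //.
rewrite -(prednK (_ : 0 < msize h)%N) ?lt0n ?msize_poly_eq0 //.
by rewrite addSn /= ltnNge leq_addl.
Qed.

(** With [W] the pairing of [w] with the coordinates, Euler's relation gives
    [W F_j = d F w_j] for every [j].  As [F] is prime and divides no nonzero
    partial derivative, it divides [W], and cancelling [F] concludes.  In other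
    words, [F] and a nonzero partial derivative form a regular sequence in the
    Jacobian ideal. *)
Lemma parallel_gradient (w : 'I_n -> {mpoly K[n]}) :
  (forall i j, w i * F^`M(j) = w j * F^`M(i)) -> exists h, forall i, w i = h * F^`M(i).
Proof.
move=> wF; pose W := \sum_i 'X_i * w i.
have WF j : W * F^`M(j) = F * w j * d%:R%:MP.
  rewrite mulrAC eulerF !mulr_suml; apply: eq_bigr => i _.
  by rewrite -!mulrA wF [w j * _]mulrC.
have [j Fj] := exists_mderiv_neq0.
have [|[h hE]|/(not_mdivides_mderiv Fj)[]] := @F_prime W F^`M(j).
  by exists (w j * d%:R%:MP); rewrite WF -mulrA mulrC.
exists (h * (d%:R^-1)%:MP) => i; apply: (mulfI F_neq0); apply: (mulIf natC_neq0).
rewrite -WF hE [RHS](_ : _ = h * F * F^`M(i) * ((d%:R^-1)%:MP * d%:R%:MP)); last by ring.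
by rewrite -mpolyCM mulVf ?mulr1 // pnatr_eq0 -lt0n.
Qed.

(** A common divisor of the partial derivatives divides [F] by Euler's relation;
    it is not an associate of [F] because of its degree. *)
Lemma gradient_gcd g : (forall i, mdivides g F^`M(i)) -> g \is a GRing.unit.
Proof.
move=> gF; have [u uE] := choice gF.
have [v Fv] : mdivides g F.
  exists ((\sum_i 'X_i * u i) * (d%:R^-1)%:MP); apply: (mulIf natC_neq0).
  rewrite eulerF [RHS](_ : _ = (\sum_i 'X_i * u i) * g * ((d%:R^-1)%:MP * d%:R%:MP)); last by ring.
  rewrite -mpolyCM mulVf ?pnatr_eq0 -?lt0n // mulr1 mulr_suml.
  by apply: eq_bigr => i _; rewrite uE mulrA.
have [|[w wE]|[w wE]] := @F_prime v g; first by exists 1; rewrite mul1r.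
  apply/unitrPr; exists w; apply: (mulfI F_neq0).
  by rewrite mulr1 {2}Fv wE; ring.
have [i Fi] := exists_mderiv_neq0; case: (not_mdivides_mderiv Fi).
by exists (u i * w); rewrite uE wE mulrA.
Qed.

End PrimeForm.

Section Pihomog.
Variables (n : nat) (R : comNzRingType).
Implicit Types p : {mpoly R[n]}.

Lemma mcoeff_pihomog p m : (pihomog mdeg (mdeg m) p)@_m = p@_m.
Proof.
have := congr1 (mcoeff m) (pihomog_partitionE (leqnn (msize p))).
rewrite raddf_sum /= => ->; have [mp|pm] := ltnP (mdeg m) (msize p).
  rewrite (bigD1 (Ordinal mp)) //= big1 ?addr0 // => i im.
  by apply: (dhomog_nemf_coeff (pihomogP _ _ _)); rewrite eq_sym.
rewrite big1 => [|i _]; last first.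
  by apply: (dhomog_nemf_coeff (pihomogP _ _ _)); rewrite eq_sym ltn_eqF // (leq_trans _ pm).
rewrite pihomogE raddf_sum /= big_seq_cond big1 // => m' /andP[/msize_mdeg_lt m'p /eqP E].
by rewrite E ltnNge pm in m'p.
Qed.

Lemma pihomog_top_neq0 p : p != 0 -> pihomog mdeg (msize p).-1 p != 0.
Proof.
move=> p0; rewrite -mlead_deg //=; apply/eqP => /(congr1 (mcoeff (mlead p))).
by rewrite mcoeff_pihomog mcoeff0 => /eqP; rewrite mleadc_eq0 (negPf p0).
Qed.

End Pihomog.

(** * Cross products *)

Definition o0 : 'I_3 := @Ordinal 3 0 isT.
Definition o1 : 'I_3 := @Ordinal 3 1 isT.
Definition o2 : 'I_3 := @Ordinal 3 2 isT.

Lemma forall_ord3 (P : 'I_3 -> Prop) : P o0 -> P o1 -> P o2 -> forall i, P i.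
Proof.
move=> P0 P1 P2 [[|[|[|//]]] i3].
- by rewrite (_ : Ordinal _ = o0) //; apply/val_inj.
- by rewrite (_ : Ordinal _ = o1) //; apply/val_inj.
- by rewrite (_ : Ordinal _ = o2) //; apply/val_inj.
Qed.

Lemma sum_ord3 (V : nmodType) (E : 'I_3 -> V) : \sum_i E i = E o0 + E o1 + E o2.
Proof.
rewrite !big_ord_recl big_ord0 addr0 addrA.
by congr (E _ + E _ + E _); apply/val_inj.
Qed.

Section Cross.
Variable R : comNzRingType.
Implicit Types a b c : 'rV[R]_3.

Definition row3 (x y z : R) : 'rV[R]_3 := \row_i [:: x; y; z]`_i.

Definition cross a b := row3
  (a 0 o1 * b 0 o2 - a 0 o2 * b 0 o1)
  (a 0 o2 * b 0 o0 - a 0 o0 * b 0 o2)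
  (a 0 o0 * b 0 o1 - a 0 o1 * b 0 o0).

Definition dot a b := \sum_i a 0 i * b 0 i.

Lemma eq_row3 a b : a 0 o0 = b 0 o0 -> a 0 o1 = b 0 o1 -> a 0 o2 = b 0 o2 -> a = b.
Proof. by move=> ? ? ?; apply/rowP; apply: forall_ord3. Qed.

Lemma row3E x y z : (row3 x y z 0 o0 = x) * (row3 x y z 0 o1 = y) * (row3 x y z 0 o2 = z).
Proof. by rewrite !mxE. Qed.

Lemma crossDr a b c : cross a (b + c) = cross a b + cross a c.
Proof. by apply: eq_row3; rewrite !mxE /=; ring. Qed.

Lemma crossZr (x : R) a b : cross a (x *: b) = x *: cross a b.
Proof. by apply: eq_row3; rewrite !mxE /=; ring. Qed.

Lemma crossNC a b : cross b a = - cross a b.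
Proof. by apply: eq_row3; rewrite !mxE /=; ring. Qed.

Lemma crossvv a : cross a a = 0.
Proof. by apply: eq_row3; rewrite !mxE /=; ring. Qed.

Lemma cross_parallel a b : cross a b = 0 -> forall i j, a 0 i * b 0 j = a 0 j * b 0 i.
Proof.
move=> /rowP ab; have := (ab o0, ab o1, ab o2); rewrite !mxE /=.
move=> [[/eqP + /eqP] + /eqP]; rewrite !subr_eq0 => /eqP E0 /eqP E1 /eqP E2.
by apply: forall_ord3; apply: forall_ord3.
Qed.

Lemma triple_product a b c : dot (cross a b) c = dot a (cross b c).
Proof. by rewrite /dot !sum_ord3 !mxE /=; ring. Qed.

Lemma crossA a b c : cross a (cross b c) = dot a c *: b - dot a b *: c.
Proof. by apply: eq_row3; rewrite !mxE /dot !sum_ord3 /=; ring. Qed.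

Lemma dotC a b : dot a b = dot b a.
Proof. by apply: eq_bigr => i _; rewrite mulrC. Qed.

Lemma dotNr a b : dot a (- b) = - dot a b.
Proof. by rewrite /dot -sumrN; apply: eq_bigr => i _; rewrite mxE mulrN. Qed.

Lemma dot0r a : dot a 0 = 0.
Proof. by rewrite /dot big1 // => i _; rewrite mxE mulr0. Qed.

Lemma cross0r a : cross a 0 = 0.
Proof. by rewrite -(scale0r a) crossZr !scale0r. Qed.

Lemma cross_cross a b c :
  cross (cross a c) (cross b c) = dot (cross a b) c *: c.
Proof. by apply: eq_row3; rewrite !mxE /dot !sum_ord3 !mxE /=; ring. Qed.

(** With the unit vectors for [a] and [b]. *)
Lemma cross_coordinate k : exists a b, forall c : 'rV[R]_3, dot (cross a b) c = c 0 k.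
Proof.
elim/forall_ord3: k; [exists (row3 0 1 0), (row3 0 0 1)|
  exists (row3 0 0 1), (row3 1 0 0)|exists (row3 1 0 0), (row3 0 1 0)];
  by move=> c; rewrite /dot !sum_ord3 !mxE /=; ring.
Qed.

Lemma cross_span2 a b u v u' v' :
  cross (u *: a + v *: b) (u' *: a + v' *: b) = (u * v' - v * u') *: cross a b.
Proof. by apply: eq_row3; rewrite !mxE /=; ring. Qed.

Lemma cross_span3 a b c u v w u' v' w' :
  cross (u *: a + v *: b + w *: c) (u' *: a + v' *: b + w' *: c) =
  (u * v' - v * u') *: cross a b + (u * w' - w * u') *: cross a c +
  (v * w' - w * v') *: cross b c.
Proof. by apply: eq_row3; rewrite !mxE /=; ring. Qed.

(** The left-hand side is, up to sign, a coordinate of the double cross product of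
    [x] with [cross a b], which [crossA] expands in [a] and [b]. *)
Lemma minor_double_cross (x a b : 'rV[R]_3) i j : exists s t,
  x 0 i * cross a b 0 j - x 0 j * cross a b 0 i = s * dot x a + t * dot x b.
Proof.
elim/forall_ord3: i; elim/forall_ord3: j; [exists 0, 0|
  exists (- b 0 o2), (a 0 o2)|exists (b 0 o1), (- a 0 o1)|
  exists (b 0 o2), (- a 0 o2)|exists 0, 0|exists (- b 0 o0), (a 0 o0)|
  exists (- b 0 o1), (a 0 o1)|exists (b 0 o0), (- a 0 o0)|exists 0, 0];
  by rewrite /dot !sum_ord3 !mxE /=; ring.
Qed.

End Cross.

(** Orthogonality to a nonzero vector passes to every parallel vector, without
    leaving the domain for its field of fractions. *)
Lemma dot_parallel (R : idomainType) (a b c : 'rV[R]_3) :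
  cross b c = 0 -> b != 0 -> dot a b = 0 -> dot a c = 0.
Proof.
move=> /cross_parallel bc b0 ab.
have [i bi] : exists i, b 0 i != 0.
  apply: contrapT => nb; case/eqP: b0; apply/rowP => i; rewrite mxE.
  by apply: contrapT => /eqP bi; apply: nb; exists i.
apply: (mulfI bi); rewrite mulr0 -(mulr0 (c 0 i)) -ab /dot !mulr_sumr.
by apply: eq_bigr => j _; rewrite mulrCA (bc i j); ring.
Qed.

(** * Syzygies of the gradient of a prime form *)

Section Syzygies.
Variables (K : numFieldType) (F : {mpoly K[3]}) (d : nat).
Local Notation S := {mpoly K[3]}.
Local Notation grad := (mdiff F).
Implicit Types a b : 'rV[S]_3.
Hypothesis d_gt0 : (0 < d)%N.
Hypothesis F_homog : F \is d.-homog.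
Hypothesis F_neq0 : F != 0.
Hypothesis F_prime : forall p q, mdivides F (p * q) -> mdivides F p \/ mdivides F q.

Lemma AR_dotE a : AR F a <-> dot a grad = 0.
Proof.
by rewrite /AR (_ : grad_pairing F a = dot a grad) //; apply: eq_bigr => i _; rewrite mxE.
Qed.

Lemma grad_neq0 : grad != 0.
Proof.
have [i Fi] := exists_mderiv_neq0 d_gt0 F_homog F_neq0.
by apply: contraNneq Fi => /rowP/(_ i); rewrite !mxE => ->.
Qed.

Lemma grad_homog : homog_mx d.-1 grad.
Proof. by move=> i j; rewrite mxE; apply: mderiv_homog. Qed.

(** Both syzygies are orthogonal to the gradient, so their cross product is
    parallel to it; primality of [F] makes the factor a polynomial.  This factor
    is the main invariant of a pair of syzygies below. *)
Lemma cross_AR a b : AR F a -> AR F b -> exists h, cross a b = h *: grad.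
Proof.
move=> /AR_dotE aF /AR_dotE bF.
have [|h hE] := @parallel_gradient _ _ F d d_gt0 F_homog F_neq0 F_prime (cross a b 0); last first.
  by exists h; apply/rowP => i; rewrite hE !mxE.
move=> i j; have := @cross_parallel _ grad (cross a b) _ i j.
rewrite crossA ![dot grad _]dotC aF bF !scale0r subrr => /(_ erefl).
by rewrite !mxE => E; rewrite mulrC -E mulrC.
Qed.

Lemma AR_cross a : AR F (cross a grad).
Proof.
by apply/AR_dotE; rewrite triple_product crossvv /dot big1 // => i _; rewrite mxE mulr0.
Qed.

(** The Koszul syzygies show that the factors of [cross_AR] generate an ideal that
    contains all partial derivatives. *)
Lemma koszul_cross k : exists a b, [/\ AR F a, AR F b & cross a b = F^`M(k) *: grad].
Proof.
suff [a [b E]] : exists a b : 'rV[S]_3, dot (cross a b) grad = F^`M(k).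
  exists (cross a grad), (cross b grad); split; try exact: AR_cross.
  by rewrite cross_cross E.
have [a [b E]] := cross_coordinate S k; exists a, b.
by rewrite E mxE.
Qed.

Lemma AR_cancel (g : S) a : g != 0 -> AR F (g *: a) -> AR F a.
Proof.
move=> g0 /AR_dotE ga; apply/AR_dotE; apply: (mulfI g0); rewrite mulr0 -[RHS]ga /dot mulr_sumr.
by apply: eq_bigr => i _; rewrite !mxE mulrA.
Qed.

Lemma AR_scale (g : S) a : AR F a -> AR F (g *: a).
Proof.
move=> /AR_dotE aF; apply/AR_dotE; rewrite -(mulr0 g) -aF /dot mulr_sumr.
by apply: eq_bigr => i _; rewrite !mxE mulrA.
Qed.

Lemma AR_add a b : AR F a -> AR F b -> AR F (a + b).
Proof.
move=> /AR_dotE aF /AR_dotE bF; apply/AR_dotE; rewrite -(addr0 0) -{1}aF -bF /dot -big_split.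
by apply: eq_bigr => i _; rewrite !mxE mulrDl.
Qed.

Definition homog_row q a : 'rV[S]_3 := \row_i pihomog mdeg q (a 0 i).

Lemma homog_rowP q a : homog_mx q (homog_row q a).
Proof. by move=> i j; rewrite mxE pihomogP. Qed.

Lemma AR_homog_row q a : AR F a -> AR F (homog_row q a).
Proof.
move=> /(congr1 (pihomog mdeg (q + d.-1))); rewrite raddf0 /grad_pairing raddf_sum /= => E.
rewrite /AR /grad_pairing -[RHS]E; apply: eq_bigr => i _.
by rewrite mxE /= pihomogM // mderiv_homog.
Qed.

Definition minimal_syzygy r (r1 : 'rV[S]_3) : Prop :=
  [/\ AR F r1, homog_mx r r1, r1 != 0 &
      forall q a, AR F a -> homog_mx q a -> a != 0 -> (r <= q)%N].

Lemma row_neq0 a : a != 0 -> exists i, a 0 i != 0.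
Proof.
move=> a0; apply: contrapT => na; case/eqP: a0; apply/rowP => i; rewrite mxE.
by apply: contrapT => /eqP ai; apply: na; exists i.
Qed.

(** Write [r1 = g c] with [c] primitive.  Then [c] is again a syzygy, and so are
    its homogeneous components; a nonconstant [g] would make one of them of
    degree less than [r].  So [r1] itself is primitive. *)
Lemma minimal_syzygy_sat r r1 a : minimal_syzygy r r1 -> cross r1 a = 0 ->
  exists u, a = u *: r1.
Proof.
move=> [r1F r1h r10 r1min] /cross_parallel r1a.
have [g [c [prim_c r1E]]] := mpoly_primitive_parts (r1 0).
have {}r1E : r1 = g *: \row_i c i by apply/rowP => i; rewrite !mxE r1E.
have g0 : g != 0 by apply: contraNneq r10 => g0; rewrite r1E g0 scale0r.
have cF : AR F (\row_i c i) by apply: (AR_cancel g0); rewrite -r1E.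
have [i0 ci0] : exists i, c i != 0.
  have [i ri] := row_neq0 r10; move: ri; rewrite r1E !mxE mulf_eq0 negb_or => /andP[_ ci].
  by exists i.
have [g_const gE] : exists2 x : K, x != 0 & g = x%:MP.
  have rD : (r <= (msize (c i0)).-1)%N.
    apply: (r1min _ (homog_row (msize (c i0)).-1 (\row_i c i))).
    - exact: AR_homog_row.
    - exact: homog_rowP.
    - apply: contraNneq (pihomog_top_neq0 ci0) => /rowP/(_ i0).
      by rewrite !mxE => ->.
  have r1i0 : r1 0 i0 = g * c i0 by rewrite r1E !mxE.
  have := r1h 0 i0; rewrite r1i0 => /(msize_dhomog _) -/(_ (mulf_neq0 g0 ci0)).
  rewrite msizeM // => sz.
  have sg : (msize g <= 1)%N.
    have := g0; rewrite -msize_poly_eq0; have := ci0; rewrite -msize_poly_eq0.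
    move: sz rD; case: (msize g) => [//|x]; case: (msize (c i0)) => [//|y] /=.
    by rewrite addnS => -[<-]; rewrite -[X in (_ <= X)%N]add0n leq_add2r leqn0 => /eqP ->.
  by have gC := msize1_polyC sg; exists (g@_0%MM) => //; rewrite -(mpolyC_eq0 3) -gC.
move=> gE'; have [k kE] : exists k, forall i, a 0 i = k * c i.
  apply: (prim_c (c i0) (a 0 i0)) => // i; apply: (mulfI g0).
  have := r1a i0 i; rewrite r1E !mxE !mulrA => ->.
  by rewrite mulrAC.
exists (k * (g_const^-1)%:MP); rewrite r1E scalerA -mulrA gE' -mpolyCM mulVf // mulr1.
by apply/rowP => i; rewrite !mxE.
Qed.

End Syzygies.

(** * Dimensions of homogeneous components *)

Section Dimensions.
Variables (K : fieldType) (n : nat).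
Local Notation S := {mpoly K[n.+1]}.
Local Notation V k l q := {ffun 'I_k * 'I_l -> dhomog n.+1 K q}.

Definition dhomog_of_mx k l q (A : 'M[S]_(k, l)) (hA : homog_mx q A) : V k l q :=
  [ffun ij => DHomog (hA ij.1 ij.2)].

Lemma dhomog_of_mxK k l q (A : 'M[S]_(k, l)) (hA : homog_mx q A) :
  mx_of_dhomog (dhomog_of_mx hA) = A.
Proof. by apply/matrixP => i j; rewrite mxE ffunE. Qed.

Lemma mx_of_dhomog_homog k l q (v : V k l q) : homog_mx q (mx_of_dhomog v).
Proof. by move=> i j; rewrite mxE; apply: dhomog_is_dhomog. Qed.

Lemma mx_of_dhomog_inj k l q : injective (@mx_of_dhomog K n k l q).
Proof.
move=> v w /matrixP vw; apply/ffunP => -[i j]; apply/val_inj.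
by have := vw i j; rewrite !mxE.
Qed.

Lemma mx_of_dhomogP k l q c (v w : V k l q) :
  mx_of_dhomog (c *: v + w) = c%:MP *: mx_of_dhomog v + mx_of_dhomog w.
Proof. by apply/matrixP => i j; rewrite !mxE !ffunE /= mul_mpolyC. Qed.

Lemma mx_of_dhomog0 k l q : mx_of_dhomog (0 : V k l q) = 0.
Proof. by apply/matrixP => i j; rewrite !mxE ffunE. Qed.

Lemma mx_of_dhomogD k l q (v w : V k l q) :
  mx_of_dhomog (v + w) = mx_of_dhomog v + mx_of_dhomog w.
Proof. by apply/matrixP => i j; rewrite !mxE !ffunE. Qed.

Section Component.
Variables (k l q : nat).
Implicit Types P : 'M[S]_(k, l) -> Prop.

Lemma homog_part_subv P1 P2 : linear_mx_subset P1 -> linear_mx_subset P2 ->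
  (forall A, homog_mx q A -> P1 A -> P2 A) -> (homog_part P1 q <= homog_part P2 q)%VS.
Proof.
move=> lP1 lP2 P12; apply/subvP => v; rewrite (mem_homog_part lP1) => P1v.
by rewrite (mem_homog_part lP2); apply: P12 P1v; apply: mx_of_dhomog_homog.
Qed.

(** This is how the dimension hypotheses produce new syzygies. *)
Lemma exists_not_homog_part P1 P2 : linear_mx_subset P1 -> linear_mx_subset P2 ->
  (\dim (homog_part P1 q) < \dim (homog_part P2 q))%N ->
  exists A, [/\ homog_mx q A, P2 A & ~ P1 A].
Proof.
move=> lP1 lP2; rewrite ltnNge => /negP d12; apply: contrapT => nA; apply: d12.
apply/dimvS/homog_part_subv => // A hA P2A; apply: contrapT => nP1A; apply: nA.
by exists A.
Qed.

Lemma homog_part_eq0P P : linear_mx_subset P ->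
  homog_part P q = 0%VS <-> (forall A, homog_mx q A -> P A -> A = 0).
Proof.
move=> lP; split=> [P0 A hA PA|P0].
  apply: contrapT => /eqP A0; have := homog_part_neq0 lP PA hA A0.
  by rewrite P0 eqxx.
apply/eqP; rewrite -subv0; apply/subvP => v; rewrite (mem_homog_part lP) memv0 => Pv.
apply/eqP/mx_of_dhomog_inj; rewrite mx_of_dhomog0; apply: P0 Pv.
exact: mx_of_dhomog_homog.
Qed.

Lemma dim_homog_part_sum P P1 P2 :
  linear_mx_subset P -> linear_mx_subset P1 -> linear_mx_subset P2 ->
  (forall A, homog_mx q A -> P1 A -> P A) -> (forall A, homog_mx q A -> P2 A -> P A) ->
  (forall A, homog_mx q A -> P A -> exists A1 A2,
     [/\ homog_mx q A1, homog_mx q A2, P1 A1, P2 A2 & A = A1 + A2]) ->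
  (forall A, homog_mx q A -> P1 A -> P2 A -> A = 0) ->
  \dim (homog_part P q) = (\dim (homog_part P1 q) + \dim (homog_part P2 q))%N.
Proof.
move=> lP lP1 lP2 P1P P2P PD P12; rewrite -dimv_disjoint_sum; last first.
  apply/eqP; rewrite -subv0; apply/subvP => v /memv_capP[].
  rewrite (mem_homog_part lP1) (mem_homog_part lP2) memv0 => P1v P2v.
  apply/eqP/mx_of_dhomog_inj; rewrite mx_of_dhomog0.
  by apply: P12 P1v P2v; apply: mx_of_dhomog_homog.
congr (\dim _); apply: subv_anti; apply/andP; split.
  apply/subvP => v; rewrite (mem_homog_part lP) => /PD -/(_ (@mx_of_dhomog_homog _ _ _ _)).
  case=> A1 [A2 [h1 h2 P1A P2A vE]].
  rewrite (_ : v = dhomog_of_mx h1 + dhomog_of_mx h2).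
    by rewrite memv_add ?(mem_homog_part lP1) ?(mem_homog_part lP2) ?dhomog_of_mxK.
  by apply: mx_of_dhomog_inj; rewrite mx_of_dhomogD !dhomog_of_mxK.
by rewrite subv_add !homog_part_subv.
Qed.

End Component.

Definition multiples k l (B A : 'M[S]_(k, l)) : Prop := exists u, A = u *: B.

Lemma multiples_linear k l (B : 'M[S]_(k, l)) : linear_mx_subset (multiples B).
Proof.
split=> [|c A A' [u ->] [u' ->]]; first by exists 0; rewrite scale0r.
by exists (c%:MP * u + u'); rewrite scalerDl scalerA.
Qed.

(** The factor is replaced by its component of degree [q]. *)
Lemma homog_multiple k l m q (B A : 'M[S]_(k, l)) :
  homog_mx m B -> homog_mx (q + m) A -> multiples B A ->
  exists2 u : S, u \is q.-homog & A = u *: B.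
Proof.
move=> hB hA [u uE]; exists (pihomog mdeg q u); first exact: pihomogP.
apply/matrixP => i j; rewrite !mxE -(pihomogM _ _ (hB i j)).
by have /pihomog_dE <- := hA i j; rewrite uE mxE.
Qed.

Lemma dim_multiples k l m q (B : 'M[S]_(k, l)) : homog_mx m B -> B != 0 ->
  \dim (homog_part (multiples B) (q + m)) = 'C(q + n, n).
Proof.
move=> hB B0.
have hphi (u : dhomog n.+1 K q) : homog_mx (q + m) (mpoly_of_dhomog u *: B).
  by move=> i j; rewrite mxE dhomogM ?dhomog_is_dhomog.
pose phi (u : dhomog n.+1 K q) : V k l (q + m) := dhomog_of_mx (hphi u).
have phiE u : mx_of_dhomog (phi u) = mpoly_of_dhomog u *: B by apply: dhomog_of_mxK.
have phi_lin : linear phi.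
  move=> c u v; apply: mx_of_dhomog_inj; rewrite mx_of_dhomogP !phiE /=.
  by rewrite scalerDl scalerA mul_mpolyC.
pose phiL := GRing.isLinear.Build K _ _ _ phi phi_lin.
pose phiM : {linear dhomog n.+1 K q -> V k l (q + m)} := HB.pack phi phiL.
have phiK : lker (linfun phiM) == 0%VS.
  apply/lker0P => u v; rewrite !lfunE /= => /(congr1 (@mx_of_dhomog K n k l _)).
  rewrite !phiE => /matrixP uv; apply/val_inj => /=.
  have [i [j Bij]] : exists i j, B i j != 0.
    apply: contrapT => nB; case/eqP: B0; apply/matrixP => i j; rewrite mxE.
    by apply: contrapT => /eqP Bij; apply: nB; exists i, j.
  by have := uv i j; rewrite !mxE => /(mulIf Bij).
have -> : homog_part (multiples B) (q + m) = limg (linfun phiM).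
  apply/vspaceP => v; apply/idP/memv_imgP => [|[u _ ->]]; last first.
    by rewrite (mem_homog_part (multiples_linear B)) lfunE /= phiE; exists (mpoly_of_dhomog u).
  rewrite (mem_homog_part (multiples_linear B)) => Bv.
  have [u hu uE] := homog_multiple hB (@mx_of_dhomog_homog _ _ _ v) Bv.
  exists (DHomog hu); rewrite ?memvf // lfunE /=; apply: mx_of_dhomog_inj.
  by rewrite phiE uE.
rewrite limg_dim_eq; last by move/eqP: phiK => ->; rewrite capv0.
by rewrite dimvf /dim /= -[RHS]bin_sub ?leq_addl // addnK.
Qed.

Lemma dim_homog_part_iso k l k' l' q (P : 'M[S]_(k, l) -> Prop) (P' : 'M[S]_(k', l') -> Prop)
    (phi : 'M[S]_(k, l) -> 'M[S]_(k', l')) :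
  linear_mx_subset P -> linear_mx_subset P' ->
  (forall c A B, phi (c%:MP *: A + B) = c%:MP *: phi A + phi B) ->
  (forall A, homog_mx q A -> homog_mx q (phi A)) -> injective phi ->
  (forall A, homog_mx q A -> P A -> P' (phi A)) ->
  (forall A', homog_mx q A' -> P' A' -> exists A, [/\ homog_mx q A, P A & A' = phi A]) ->
  \dim (homog_part P q) = \dim (homog_part P' q).
Proof.
move=> lP lP' phiP phih phiI PP' P'P.
pose psi (v : V k l q) : V k' l' q := dhomog_of_mx (phih _ (mx_of_dhomog_homog v)).
have psiE v : mx_of_dhomog (psi v) = phi (mx_of_dhomog v) by apply: dhomog_of_mxK.
have psi_lin : linear psi.
  by move=> c u v; apply: mx_of_dhomog_inj; rewrite mx_of_dhomogP !psiE mx_of_dhomogP phiP.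
pose psiM : {linear V k l q -> V k' l' q} := HB.pack psi (GRing.isLinear.Build K _ _ _ psi psi_lin).
have psiK : lker (linfun psiM) == 0%VS.
  apply/lker0P => u v; rewrite !lfunE /= => /(congr1 (@mx_of_dhomog K n k' l' _)).
  by rewrite !psiE => /phiI/mx_of_dhomog_inj.
rewrite -(limg_dim_eq (f := linfun psiM)); last by move/eqP: psiK => ->; rewrite capv0.
congr (\dim _); apply/vspaceP => v; apply/memv_imgP/idP => [[u Pu ->]|].
  move: Pu; rewrite (mem_homog_part lP) (mem_homog_part lP') lfunE /= psiE => Pu.
  exact: PP' (mx_of_dhomog_homog _) Pu.
rewrite (mem_homog_part lP') => /P'P -/(_ (mx_of_dhomog_homog _))[A [hA PA vE]].
exists (dhomog_of_mx hA); first by rewrite (mem_homog_part lP) dhomog_of_mxK.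
by rewrite lfunE /=; apply: mx_of_dhomog_inj; rewrite psiE dhomog_of_mxK.
Qed.

End Dimensions.

(** * Pull-backs of 2-forms by a parametrization *)

Lemma sum_lt_ord3 (V : nmodType) (E : 'I_3 -> 'I_3 -> V) :
  \sum_(i < 3) \sum_(j < 3 | (i < j)%N) E i j = E o0 o1 + E o0 o2 + E o1 o2.
Proof.
under eq_bigr => i _ do rewrite big_mkcond.
by rewrite !sum_ord3 /= !(add0r, addr0).
Qed.

Section AlternatingMatrices.
Variable R : comNzRingType.
Implicit Types a b c : 'rV[R]_3.

(** The identification of vector fields with 2-forms on the 3-space, by contraction
    with the volume form. *)
Definition alt_mx a : 'M[R]_3 := \matrix_(i, j)
  nth 0 (nth [::] [:: [:: 0; a 0 o2; - a 0 o1];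
                      [:: - a 0 o2; 0; a 0 o0];
                      [:: a 0 o1; - a 0 o0; 0]] i) j.

Lemma alt_mxE a :
  (alt_mx a o1 o2 = a 0 o0) * (alt_mx a o2 o0 = a 0 o1) * (alt_mx a o0 o1 = a 0 o2) *
  (alt_mx a o0 o2 = - a 0 o1).
Proof. by rewrite !mxE. Qed.

Lemma alt_mxP (x : R) a b : alt_mx (x *: a + b) = x *: alt_mx a + alt_mx b.
Proof. by apply/matrixP; apply: forall_ord3; apply: forall_ord3; rewrite !mxE /=; ring. Qed.

Lemma alt_mx_inj : injective alt_mx.
Proof.
move=> a b ab; apply: eq_row3; first by rewrite -!alt_mxE ab.
  by rewrite -[LHS](alt_mxE a).1.1.2 ab alt_mxE.
by rewrite -[LHS](alt_mxE a).1.2 ab alt_mxE.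
Qed.

End AlternatingMatrices.

Section Pullback.
Variable K : numClosedFieldType.
Variables (d : nat) (f : 3.-tuple {mpoly K[2]}) (F : {mpoly K[3]}).
Hypothesis d_gt0 : (0 < d)%N.
Hypothesis f_homog : forall i, tnth f i \is d.-homog.
Hypothesis f_gcd : gcd_is_one f.
Hypothesis f_inj : generically_injective f.
Hypothesis F_homog : F \is d.-homog.
Hypothesis F_neq0 : F != 0.
Hypothesis Ff : F \mPo f = 0.

Local Notation comp_row a := (map_mx (comp_mpoly f) a).
Local Notation grad := (mdiff F).

Lemma mdivides_equationP p : mdivides F p <-> p \mPo f = 0.
Proof.
split=> [[h ->]|pf]; first by rewrite rmorphM /= Ff mulr0.
exact: (parametrization_kernel d_gt0 f_homog).
Qed.

Lemma equation_prime p q : mdivides F (p * q) -> mdivides F p \/ mdivides F q.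
Proof.
by rewrite !mdivides_equationP rmorphM /= => /eqP; rewrite mulf_eq0 => /orP[]/eqP; [left|right].
Qed.

Definition tangent k : 'rV[{mpoly K[2]}]_3 := \row_i (tnth f i)^`M(k).

(** The chain rule, applied to the vanishing of [F] on the curve. *)
Lemma dot_comp_grad k : dot (comp_row grad) (tangent k) = 0.
Proof.
have := mderiv_comp f F k; rewrite Ff mderiv0 => ->.
by apply: eq_bigr => i _; rewrite !mxE.
Qed.

(** The vector of the 2 x 2 minors of the Jacobian matrix of the parametrization. *)
Definition jacobian_minors := cross (tangent ord0) (tangent ord_max).

(** On the curve the gradient and the minors are both normal to the two tangent
    vectors. *)
Lemma cross_grad_minors : cross (comp_row grad) jacobian_minors = 0.
Proof. by rewrite crossA !dot_comp_grad !scale0r subrr. Qed.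

Lemma comp_grad_neq0 : comp_row grad != 0.
Proof.
have [i Fi] := exists_mderiv_neq0 d_gt0 F_homog F_neq0.
apply/eqP => /rowP/(_ i); rewrite !mxE => /mdivides_equationP.
exact: not_mdivides_mderiv Fi.
Qed.

(** Otherwise the [f_i] are constant multiples of a single form; they would have a
    common zero. *)
Lemma jacobian_minors_neq0 : jacobian_minors != 0.
Proof.
apply/eqP => /cross_parallel M0.
have [|g [c fE]] := jacobian_eq0 d_gt0 f_homog.
  move=> i j k l; have := M0 i j; rewrite !mxE => Mij.
  by case: (ord2P k) => ->; case: (ord2P l) => ->; rewrite // ?Mij mulrC // Mij mulrC.
have [i /negP fi] := gcd_one_zeros f_gcd f_homog (infinity_pt_neq0 K).
have ci : c i != 0.
  by apply/eqP => ci; apply: fi; rewrite fE ci scale0r meval0.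
have [u [u0 fu]] := binary_form_zero (f_homog i) d_gt0.
have [j /negP] := gcd_one_zeros f_gcd f_homog u0; case; rewrite fE mevalZ.
by move: fu => /eqP; rewrite fE mevalZ mulf_eq0 (negPf ci) => /eqP ->; rewrite mulr0.
Qed.

(** Each coefficient of the pull-back is the triple product of the field along the
    curve with two tangent vectors. *)
Lemma pullback_alt_mx a :
  pullback f (alt_mx a) = 0 <-> dot (comp_row a) jacobian_minors = 0.
Proof.
have E k l : pullback f (alt_mx a) k l =
    dot (comp_row a) (cross (tangent k) (tangent l)).
  rewrite /pullback sum_lt_ord3 !alt_mxE.
  by rewrite /dot sum_ord3 !mxE /= rmorphN /=; ring.
split=> [/matrixP/(_ ord0 ord_max)|M0]; first by rewrite E mxE.
apply/matrixP => k l; rewrite E [RHS]mxE.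
case: (ord2P k) => ->; case: (ord2P l) => ->.
- by rewrite crossvv dot0r.
- exact: M0.
- by rewrite crossNC dotNr -/jacobian_minors M0 oppr0.
- by rewrite crossvv dot0r.
Qed.

(** Along the curve, orthogonality to the gradient and to the minors are the same
    condition; orthogonality of [a] to the gradient along the curve means that
    [F] divides the pairing of [a] with the gradient. *)
Lemma ARE_pullback a : ARE F a <-> pullback f (alt_mx a) = 0.
Proof.
have -> : ARE F a <-> dot (comp_row a) (comp_row grad) = 0.
  rewrite /ARE mdivides_equationP (_ : _ \mPo f = dot (comp_row a) (comp_row grad)) //.
  rewrite raddf_sum; apply: eq_bigr => i _ /=.
  by rewrite !mxE rmorphM.
rewrite pullback_alt_mx; split; first exact: dot_parallel cross_grad_minors comp_grad_neq0.
apply: dot_parallel jacobian_minors_neq0.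
by rewrite crossNC cross_grad_minors oppr0.
Qed.

Theorem dim_pullback_ker_ARE q : dim_pullback_ker f q = \dim (homog_part (ARE F) q).
Proof.
apply/esym/(dim_homog_part_iso (phi := @alt_mx _)).
- exact: ARE_linear.
- exact: pullback_ker_linear.
- by move=> c A B; rewrite alt_mxP.
- move=> A hA; apply: forall_ord3; apply: forall_ord3; rewrite mxE /= ?rpredN ?rpred0 //; exact: hA.
- exact: alt_mx_inj.
- move=> A _ /ARE_pullback pA; split=> //.
  by apply: forall_ord3; apply: forall_ord3; split; rewrite !mxE /= ?opprK ?oppr0.
move=> w hw [w2 wf]; pose a := row3 (w o1 o2) (w o2 o0) (w o0 o1).
have wE : w = alt_mx a.
  have wii i : w i i = 0 by have [] := w2 i i.
  have wji i j : w j i = - w i j by have [] := w2 i j.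
  apply/matrixP; apply: forall_ord3; apply: forall_ord3;
    by rewrite /a !mxE /= ?wii // ?[w o1 o0]wji ?[w o2 o1]wji ?[w o0 o2]wji.
exists a; split=> //; last by apply/ARE_pullback; rewrite -wE.
by move=> i; rewrite (ord1 i); apply: forall_ord3; rewrite mxE; apply: hw.
Qed.

End Pullback.

(** * Splitting off the Euler field *)

Section EulerSplitting.
Variables (K : numFieldType) (d : nat) (F : {mpoly K[3]}).
Hypothesis d_gt0 : (0 < d)%N.
Hypothesis F_homog : F \is d.-homog.
Hypothesis F_neq0 : F != 0.
Local Notation S := {mpoly K[3]}.

Definition euler_field : 'rV[S]_3 := \row_i 'X_i.

Lemma euler_fieldE i : euler_field 0 i = 'X_i.
Proof. by rewrite mxE. Qed.

Lemma euler_field_neq0 : euler_field != 0.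
Proof. by apply/eqP => /rowP/(_ 0); rewrite !mxE; apply/eqP/mpolyXU_neq0. Qed.

Lemma euler_field_homog : homog_mx 1 euler_field.
Proof. by move=> i j; rewrite mxE dhomogX; apply/eqP/mdeg1. Qed.

Lemma grad_pairing_euler u : grad_pairing F (u *: euler_field) = u * d%:R%:MP * F.
Proof.
rewrite -mulrA [_ * F]mulrC (eulerF F_homog) /grad_pairing mulr_sumr.
by apply: eq_bigr => i _; rewrite !mxE mulrA.
Qed.

Lemma grad_pairing_homog q (A : 'rV[S]_3) : homog_mx q A -> grad_pairing F A \is (q + d.-1).-homog.
Proof. by move=> hA; apply: rpred_sum => i _; rewrite dhomogM ?mderiv_homog. Qed.

(** For [q = 0] the degree of the product is less than that of [F]. *)
Lemma homog_quotient q (h : S) : h * F \is (q + d.-1).-homog ->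
  h = 0 \/ exists2 q', q = q'.+1 & h \is q'.-homog.
Proof.
move=> hF; have [->|h0] := eqVneq h 0; [by left|right].
case: q hF => [|q] hF.
  have := msize_dhomog (mulf_neq0 h0 F_neq0) hF.
  rewrite msizeM // (msize_dhomog F_neq0 F_homog) add0n addnS /= prednK //.
  rewrite -[X in _ = X]add0n => /eqP; rewrite eqn_add2r msize_poly_eq0.
  by rewrite (negPf h0).
exists q => //; rewrite homog_piE; apply/eqP/(mulIf F_neq0).
rewrite -(pihomogM _ _ F_homog) pihomog_dE //.
by move: hF; rewrite addSnnS prednK.
Qed.

(** The Euler field sends [F] to [d F], so that subtracting a multiple of it turns
    an element of [ARE F] into an element of [AR F], in a unique way.  The
    multiples of the Euler field account for the binomial coefficient. *)
Theorem dim_ARE q :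
  \dim (homog_part (ARE F) q) = ('C(q + 1, 2) + \dim (homog_part (AR F) q))%N.
Proof.
have dC0 := natC_neq0 K 3 d_gt0.
rewrite (dim_homog_part_sum (P1 := multiples euler_field) (P2 := AR F)) //; first last.
- move=> A _ [u ->]; rewrite /AR grad_pairing_euler => /eqP.
  rewrite !mulf_eq0 (negPf F_neq0) (negPf dC0) !orbF => /eqP ->.
  by rewrite scale0r.
- move=> A hA [h hE]; have hF : h * F \is (q + d.-1).-homog.
    by rewrite -hE grad_pairing_homog.
  pose u := h * (d%:R^-1)%:MP; have uE : grad_pairing F (u *: euler_field) = h * F.
    rewrite grad_pairing_euler -(mulrA h) -mpolyCM mulVf ?mulr1 // pnatr_eq0 -lt0n //.
  exists (u *: euler_field), (A - u *: euler_field).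
  have hu : homog_mx q (u *: euler_field).
    move=> i j; rewrite mxE /u; have [->|[q' qE hq]] := homog_quotient hF.
      by rewrite mul0r mul0r rpred0.
    rewrite qE -[q'.+1]addn1 dhomogM ?euler_field_homog //.
    by rewrite mulrC mul_mpolyC rpredZ.
  split=> //.
  + by move=> i j; rewrite mxE rpredD ?hA // mxE rpredN hu.
  + by exists u.
  + rewrite /AR addrC -scaleN1r -mpolyC1 -mpolyCN grad_pairing_linear uE hE.
    by rewrite mpolyCN mpolyC1 mulN1r addNr.
  + by rewrite addrC subrK.
- by move=> A _; rewrite /AR /ARE => ->; exists 0; rewrite mul0r.
- by move=> A _ [u ->]; exists (u * d%:R%:MP); rewrite grad_pairing_euler.
- exact: AR_linear.
- exact: multiples_linear.
- exact: ARE_linear.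
congr (_ + _)%N; case: q => [|q]; last first.
  have := dim_multiples q euler_field_homog euler_field_neq0.
  by rewrite !addn1 addn2.
suff /(homog_part_eq0P 0 (multiples_linear _)) -> :
  forall A, homog_mx 0 A -> multiples euler_field A -> A = 0.
  by rewrite dimv0.
move=> A hA [u uE]; have [u00|u0] := eqVneq u 0; first by rewrite uE u00 scale0r.
have := hA 0 0; rewrite uE !mxE => /(msize_dhomog (mulf_neq0 u0 (mpolyXU_neq0 _ _))).
rewrite msizeM ?mpolyXU_neq0 // msizeX mdeg1 addnS /= addn1 => -[/eqP].
by rewrite msize_poly_eq0 (negPf u0).
Qed.

End EulerSplitting.

(** * Linear forms in three variables *)

Section LinearForms.
Variable K : numFieldType.
Local Notation S := {mpoly K[3]}.
Implicit Types l p : S.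

Lemma homog0_const n (R : comNzRingType) (p : {mpoly R[n]}) : p \is 0.-homog -> p = (p@_0%MM)%:MP.
Proof.
move=> p0; have [->|pN0] := eqVneq p 0; first by rewrite mcoeff0 mpolyC0.
by apply: msize1_polyC; rewrite (msize_dhomog pN0 p0).
Qed.

Lemma mdiff_const l i : l \is 1.-homog -> exists c : K, mdiff l 0 i = c%:MP.
Proof.
move=> lh; exists (l^`M(i)@_0%MM); rewrite mxE; apply: homog0_const.
exact: (mderiv_homog i lh).
Qed.

Lemma dot_mdiff l : l \is 1.-homog -> l = dot (euler_field K) (mdiff l).
Proof.
move=> lh; rewrite -[LHS]mulr1n -(euler_homog lh).
by apply: eq_bigr => i _; rewrite !mxE.
Qed.

Lemma mdiff_neq0 l : l \is 1.-homog -> l != 0 -> exists j, exists2 c : K, c != 0 & mdiff l 0 j = c%:MP.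
Proof.
move=> lh l0; apply: contrapT => nl; case/eqP: l0; rewrite (dot_mdiff lh) /dot big1 // => i _.
have [c cE] := mdiff_const i lh; rewrite cE; have [->|c0] := eqVneq c 0.
  by rewrite mpolyC0 mulr0.
by case: nl; exists i, c.
Qed.

(** The substitution solves the equation [l = 0] for one of the coordinates.  Its
    target being a domain, [l] is prime. *)
Lemma linear_form_morph l : l \is 1.-homog -> l != 0 ->
  exists g : 3.-tuple S, forall p, mdivides l p <-> p \mPo g = 0.
Proof.
move=> lh l0; have [j [c c0 cj]] := mdiff_neq0 lh l0.
pose g := [tuple 'X_i - ((i == j)%:R * c^-1)%:MP * l | i < 3].
have lg : l \mPo g = 0.
  rewrite {1}(dot_mdiff lh) /dot raddf_sum /=.
  have E i : ('X_i * mdiff l 0 i) \mPo g = 'X_i * mdiff l 0 i - (if i == j then l else 0).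
    have [a aE] := mdiff_const i lh.
    rewrite aE rmorphM /= comp_mpolyC comp_mpolyXU -tnth_nth tnth_mktuple.
    rewrite mulrBl; congr (_ - _); case: eqP => [ij|_]; last by rewrite mul0r mpolyC0 !mul0r.
    move: aE; rewrite ij cj => ac; rewrite -ac mul1r mulrAC -mpolyCM mulVf //.
    by rewrite mpolyC1 mul1r.
  under eq_bigr => i _ do rewrite euler_fieldE E.
  rewrite sumrB -big_mkcond big_pred1_eq {2}(dot_mdiff lh) -sumrB big1 // => i _.
  by rewrite !mxE subrr.
exists g => p; split=> [[h ->]|pg]; first by rewrite rmorphM /= lg mulr0.
have [q qE] := sub_comp_mpoly g p; move: qE; rewrite pg subr0 => ->.
exists (q j * (c^-1)%:MP); rewrite (bigD1 j) //= big1 => [|i ij].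
  by rewrite addr0 tnth_mktuple eqxx mul1r opprB addrC subrK mulrA.
by rewrite tnth_mktuple (negPf ij) mul0r mpolyC0 mul0r subr0 subrr mulr0.
Qed.

Lemma linear_form_prime l p q : l \is 1.-homog -> l != 0 ->
  mdivides l (p * q) -> mdivides l p \/ mdivides l q.
Proof.
move=> lh l0; have [g gP] := linear_form_morph lh l0.
by rewrite !gP rmorphM /= => /eqP; rewrite mulf_eq0 => /orP[]/eqP; [left|right].
Qed.

Definition independent_forms l l' := forall c c' : K, c *: l + c' *: l' = 0 -> c = 0 /\ c' = 0.

Section Pair.
Variables l l' : S.
Hypothesis lh : l \is 1.-homog.
Hypothesis lh' : l' \is 1.-homog.
Hypothesis indep : independent_forms l l'.

Lemma independent_neq0l : l != 0.
Proof.
apply/eqP => l0; have [] := @indep 1 0.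
  by rewrite l0 scaler0 scale0r addr0.
by move=> /eqP; rewrite oner_eq0.
Qed.

Lemma independent_neq0r : l' != 0.
Proof.
apply/eqP => l0; have [] := @indep 0 1.
  by rewrite l0 scaler0 scale0r addr0.
by move=> _ /eqP; rewrite oner_eq0.
Qed.

Lemma independent_coprime a b : l * a = l' * b -> exists g, a = l' * g /\ b = l * g.
Proof.
move=> ab; have l0 := independent_neq0l.
have [|[k kE]|[g gE]] := @linear_form_prime l l' b lh l0.
- by exists a; rewrite -ab mulrC.
- have k0 : k \is 0.-homog.
    rewrite homog_piE; apply/eqP/(mulIf l0); rewrite -(pihomogM _ _ lh) -kE.
    exact: pihomog_dE.
  move: kE; rewrite (homog0_const k0) mul_mpolyC => kE.
  have [] := @indep (- k@_0%MM) 1; first by rewrite scale1r kE scaleNr addNr.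
  by move=> _ /eqP; rewrite oner_eq0.
exists g; split; last by rewrite gE mulrC.
by apply: (mulfI l0); rewrite ab gE; ring.
Qed.

(** The substitution projects the space onto the line where [l] and [l'] vanish,
    spanned by the cross product [w] of their coefficient vectors.  By
    [minor_double_cross], the coordinates and their projections agree modulo
    the ideal of [l] and [l']. *)
Lemma independent_forms_morph :
  exists g : 3.-tuple S, forall p, (exists x y, p = x * l + y * l') <-> p \mPo g = 0.
Proof.
pose w := cross (mdiff l) (mdiff l').
have wC i : exists c : K, w 0 i = c%:MP.
  have C k := mdiff_const k lh; have C' k := mdiff_const k lh'.
  have [[a0 E0] [a1 E1] [a2 E2]] := And3 (C o0) (C o1) (C o2).
  have [[b0 G0] [b1 G1] [b2 G2]] := And3 (C' o0) (C' o1) (C' o2).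
  elim/forall_ord3: i; rewrite /w /cross !row3E ?E0 ?E1 ?E2 ?G0 ?G1 ?G2 -!mpolyCM -!mpolyCB.
  - by eexists.
  - by eexists.
  - by eexists.
have [j [c c0 wj]] : exists j, exists2 c : K, c != 0 & w 0 j = c%:MP.
  apply: contrapT => nw; have w0 : w = 0.
    apply/rowP => i; have [c cE] := wC i; rewrite cE [RHS]mxE; have [->|c0] := eqVneq c 0.
      by rewrite mpolyC0.
    by case: nw; exists i, c.
  have [k [a a0 aE]] := mdiff_neq0 lh independent_neq0l.
  have [b bE] := mdiff_const k lh'.
  have := @indep (- b) a; case; last by move=> _ /eqP; rewrite (negPf a0).
  rewrite -!mul_mpolyC mpolyCN mulNr addrC -aE -bE {2}(dot_mdiff lh) {1}(dot_mdiff lh').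
  rewrite /dot !mulr_sumr -sumrB big1 // => i _.
  rewrite !(mulrCA _ (euler_field K 0 i)) -mulrBr (cross_parallel w0 k i).
  by rewrite [X in _ - X]mulrC subrr mulr0.
have Xw i : exists x y, 'X_i - (w 0 i * (c^-1)%:MP) * 'X_j = x * l + y * l'.
  have [s [t]] := minor_double_cross (euler_field K) (mdiff l) (mdiff l') i j.
  rewrite -(dot_mdiff lh) -(dot_mdiff lh') -/w !euler_fieldE => E.
  exists ((c^-1)%:MP * s), ((c^-1)%:MP * t).
  have cc : (c^-1)%:MP * c%:MP = 1 :> S by rewrite -mpolyCM mulVf.
  rewrite -!mulrA -mulrDr -E wj; move: (w 0 i) => wi.
  transitivity ((c^-1)%:MP * c%:MP * 'X_i - (c^-1)%:MP * ('X_j * wi)); last by ring.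
  by rewrite cc; ring.
pose g := [tuple (w 0 i * (c^-1)%:MP) * 'X_j | i < 3].
have gP (m : S) : m \is 1.-homog -> dot w (mdiff m) = 0 -> m \mPo g = 0.
  move=> mh wm; rewrite {1}(dot_mdiff mh) /dot raddf_sum /=.
  transitivity ((c^-1)%:MP * 'X_j * dot w (mdiff m)); last by rewrite wm mulr0.
  rewrite /dot mulr_sumr; apply: eq_bigr => i _.
  have [a aE] := mdiff_const i mh.
  rewrite aE rmorphM /= comp_mpolyC euler_fieldE comp_mpolyXU -tnth_nth tnth_mktuple.
  by ring.
have lg : l \mPo g = 0.
  by apply: gP => //; rewrite /w dotC -triple_product crossvv dotC dot0r.
have lg' : l' \mPo g = 0.
  by apply: gP => //; rewrite /w triple_product crossvv dot0r.
exists g => p; split=> [[x [y ->]]|pg].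
  by rewrite rmorphD !rmorphM /= lg lg' !mulr0 addr0.
have [q qE] := sub_comp_mpoly g p; move: qE; rewrite pg subr0 => ->.
apply: (big_ind (fun p => exists x y, p = x * l + y * l')).
- by exists 0, 0; rewrite !mul0r addr0.
- move=> _ _ [x [y ->]] [x' [y' ->]]; exists (x + x'), (y + y').
  by rewrite !mulrDl addrACA.
move=> i _; have [x [y E]] := Xw i; exists (q i * x), (q i * y).
by rewrite tnth_mktuple E mulrDr !mulrA.
Qed.

Lemma independent_forms_prime p q :
  (exists x y, p * q = x * l + y * l') ->
  (exists x y, p = x * l + y * l') \/ (exists x y, q = x * l + y * l').
Proof.
have [g gP] := independent_forms_morph.
by rewrite !gP rmorphM /= => /eqP; rewrite mulf_eq0 => /orP[]/eqP; [left|right].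
Qed.

End Pair.
End LinearForms.

(** * Free curves *)

Section RowComponents.
Variable K : numFieldType.
Local Notation S := {mpoly K[3]}.
Implicit Types a b : 'rV[S]_3.

Definition coef_part q e (u : S) : S := if (e <= q)%N then pihomog mdeg (q - e) u else 0.

Lemma homog_rowD q a b : homog_row q (a + b) = homog_row q a + homog_row q b.
Proof. by apply/rowP => i; rewrite !mxE raddfD. Qed.

Lemma homog_row_id q a : homog_mx q a -> homog_row q a = a.
Proof. by move=> ha; apply/rowP => i; rewrite mxE pihomog_dE. Qed.

Lemma homog_rowZ q e u a : homog_mx e a -> homog_row q (u *: a) = coef_part q e u *: a.
Proof.
move=> ha; apply/rowP => i; rewrite !mxE /coef_part.
case: leqP => [eq|qe]; last by rewrite mul0r (pihomogM_lt _ qe (ha 0 i)).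
by rewrite -{1}(subnK eq) pihomogM.
Qed.

Lemma homog_row_cross q e a b : homog_mx e a ->
  homog_row (e + q) (cross a b) = cross a (homog_row q b).
Proof.
move=> ha; apply/rowP; rewrite addnC.
by apply: forall_ord3; rewrite !mxE /= raddfB /= ![a 0 _ * _]mulrC !pihomogM ?ha // ![_ * a 0 _]mulrC.
Qed.

Lemma cross_homog e e' a b : homog_mx e a -> homog_mx e' b -> homog_mx (e + e') (cross a b).
Proof.
move=> ha hb i; rewrite (ord1 i).
by apply: forall_ord3; rewrite mxE /= rpredB ?dhomogM.
Qed.

Lemma homogD q a b : homog_mx q a -> homog_mx q b -> homog_mx q (a + b).
Proof. by move=> ha hb i j; rewrite mxE rpredD. Qed.

Lemma homogZ e q u a : u \is e.-homog -> homog_mx q a -> homog_mx (e + q) (u *: a).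
Proof. by move=> hu ha i j; rewrite mxE dhomogM. Qed.

Lemma scale_cancel (h h' : S) a : a != 0 -> h *: a = h' *: a -> h = h'.
Proof.
move=> /row_neq0[i ai] /rowP/(_ i); rewrite !mxE; exact: mulIf.
Qed.

Lemma scale_eq0 (h : S) a : a != 0 -> h *: a = 0 -> h = 0.
Proof. by move=> a0 ha; apply: (scale_cancel a0); rewrite ha scale0r. Qed.

Definition combinations b c a : Prop := exists u v : S, a = u *: b + v *: c.

Lemma combinations_linear b c : linear_mx_subset (combinations b c).
Proof.
split=> [|x a a' [u [v ->]] [u' [v' ->]]]; first by exists 0, 0; rewrite !scale0r addr0.
exists (x%:MP * u + u'), (x%:MP * v + v').
by rewrite scalerDr !scalerDl !scalerA addrACA.
Qed.

Lemma dim_combinations q e e' b c : homog_mx e b -> homog_mx e' c ->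
  (forall a, homog_mx q a -> multiples b a -> multiples c a -> a = 0) ->
  \dim (homog_part (combinations b c) q) =
  (\dim (homog_part (multiples b) q) + \dim (homog_part (multiples c) q))%N.
Proof.
move=> hb hc bc0; apply: dim_homog_part_sum => //; try exact: multiples_linear.
- exact: combinations_linear.
- by move=> a _ [u ->]; exists u, 0; rewrite scale0r addr0.
- by move=> a _ [u ->]; exists 0, u; rewrite scale0r add0r.
move=> a ha [u [v aE]]; exists (homog_row q (u *: b)), (homog_row q (v *: c)).
split; try exact: homog_rowP.
- by rewrite (homog_rowZ _ _ hb); eexists.
- by rewrite (homog_rowZ _ _ hc); eexists.
- by rewrite -homog_rowD -aE homog_row_id.
Qed.

Lemma homog_multiple_le m q a b : homog_mx m b -> homog_mx q a -> multiples b a -> (m <= q)%N ->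
  exists2 u : S, u \is (q - m).-homog & a = u *: b.
Proof. by move=> hb ha ba mq; apply: (homog_multiple hb) => //; rewrite subnK. Qed.

Lemma dim_multiples_le m q b : homog_mx m b -> b != 0 -> (m <= q)%N ->
  \dim (homog_part (multiples b) q) = 'C(q - m + 2, 2).
Proof. by move=> hb b0 mq; have := dim_multiples (q - m) hb b0; rewrite subnK. Qed.

End RowComponents.

Section Exponents.
Variables (K : numFieldType) (F : {mpoly K[3]}) (d : nat).
Local Notation S := {mpoly K[3]}.
Local Notation grad := (mdiff F).
Implicit Types a b : 'rV[S]_3.
Hypothesis d_gt0 : (0 < d)%N.
Hypothesis F_homog : F \is d.-homog.
Hypothesis F_neq0 : F != 0.
Hypothesis F_prime : forall p q, mdivides F (p * q) -> mdivides F p \/ mdivides F q.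

Let grad0 := grad_neq0 d_gt0 F_homog F_neq0.
Let gradh := grad_homog F_homog.
Let crossAR := cross_AR d_gt0 F_homog F_neq0 F_prime.

Lemma cross_degree e1 e2 m a b h : homog_mx e1 a -> homog_mx e2 b ->
  cross a b = h *: grad -> h != 0 -> h \is m.-homog -> (e1 + e2 = m + d.-1)%N.
Proof.
move=> ha hb E h0 hm; have [i Fi] := row_neq0 grad0.
apply: (@dhomog_uniq _ _ mdeg (h * grad 0 i)).
- by rewrite mulf_neq0.
- by have := cross_homog ha hb 0 i; rewrite E mxE.
- by rewrite dhomogM ?gradh.
Qed.

Lemma cross_factor_homog e1 e2 m a b h : homog_mx e1 a -> homog_mx e2 b ->
  cross a b = h *: grad -> (e1 + e2 = m + d.-1)%N -> h \is m.-homog.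
Proof.
move=> ha hb E em; have := cross_homog ha hb; rewrite em E => hE.
have [|u hu uE] := homog_multiple gradh hE; first by exists h.
by rewrite (scale_cancel grad0 uE).
Qed.

(** By [koszul_cross], such a [g] divides all partial derivatives. *)
Lemma all_crosses_unit g :
  (forall a b, AR F a -> AR F b -> exists h, cross a b = (h * g) *: grad) ->
  exists2 c : K, c != 0 & g = c%:MP.
Proof.
move=> gP; have ug : g \is a GRing.unit.
  apply: (gradient_gcd d_gt0 F_homog F_neq0 F_prime) => k.
  have [a [b [aF bF E]]] := koszul_cross F k.
  have [h hE] := gP a b aF bF; exists h.
  by apply: (scale_cancel grad0); rewrite -E hE.
have /andP[/eqP gE u0] := ug; exists (g@_0%MM) => //.
by move: u0; rewrite unitfE.
Qed.

Section MinimalSyzygy.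
Variables (r : nat) (r1 : 'rV[S]_3).
Hypothesis r1_min : minimal_syzygy F r r1.

(** For degree reasons only [s1] contributes to a syzygy of degree less than [d2],
    and nothing to one of degree less than [d1]. *)
Lemma minimal_degree_eq d1 d2 s1 :
  (d1 <= d2)%N -> AR F s1 -> homog_mx d1 s1 -> s1 != 0 ->
  (forall a, AR F a -> exists u (b c : 'rV[S]_3) v w,
     [/\ homog_mx d2 b, homog_mx d2 c & a = u *: s1 + v *: b + w *: c]) -> d1 = r.
Proof.
move=> d12 s1F s1h s10 gen; have [r1F r1h r10 rmin] := r1_min.
apply/eqP; rewrite eqn_leq (rmin _ _ s1F s1h s10) andbT leqNgt; apply/negP => rd1.
have [u [b [c [v [w [hb hc E]]]]]] := gen _ r1F.
case/eqP: r10; rewrite -(homog_row_id r1h) E !homog_rowD.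
rewrite (homog_rowZ _ _ s1h) (homog_rowZ _ _ hb) (homog_rowZ _ _ hc) /coef_part.
by rewrite leqNgt rd1 leqNgt (leq_trans rd1 d12) /= !scale0r !addr0.
Qed.

(** For a basis the factor of [cross_AR] is a unit, so the exponents add up to
    [d - 1], and the second generator is the only new syzygy of its degree.
    Conversely, a syzygy [r2] of degree [d - 1 - r] that is not a multiple of
    [r1] has a nonzero constant as the factor of [cross r1 r2] (Saito's
    criterion), and one reads the coordinates of any syzygy in the basis
    [r1], [r2] from its cross product with [r1]. *)
Theorem free_iff :
  free_curve F <-> (2 * r <= d - 1)%N /\
  \dim (homog_part (AR F) (d - r - 1)) = ('C(d - 2 * r + 1, 2) + 1)%N.
Proof.
have [r1F r1h r10 rmin] := r1_min; split.
  move=> [d1 [d2 [d12 [s1 [s2 [[s1F s1h] [s2F s2h] gen]]]]]].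
  have uniq0 u v : u *: s1 + v *: s2 = 0 -> u = 0 /\ v = 0.
    move=> uv; have [|w [_ wU]] := gen 0; first by have [] := AR_linear F.
    have w1 : w = (u, v) by apply: wU.
    have w2 : w = (0, 0) by apply: wU; rewrite /= !scale0r addr0.
    by move: w1; rewrite w2 => -[<- <-].
  have s10 : s1 != 0.
    apply/eqP => s10; have [] := uniq0 1 0; first by rewrite s10 scaler0 scale0r addr0.
    by move=> /eqP; rewrite oner_eq0.
  have s20 : s2 != 0.
    apply/eqP => s20; have [] := uniq0 0 1; first by rewrite s20 scaler0 scale0r addr0.
    by move=> _ /eqP; rewrite oner_eq0.
  have d1r : d1 = r.
    apply: (minimal_degree_eq d12 s1F s1h s10) => a /gen[[u v] [/= aE _]].
    by exists u, s2, s2, v, 0; split=> //; rewrite scale0r addr0.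
  have [h hE] := crossAR s1F s2F.
  have [c c0 hc] : exists2 c : K, c != 0 & h = c%:MP.
    apply: all_crosses_unit => a b /gen[[u v] [/= -> _]] /gen[[u' v'] [/= -> _]].
    by exists (u * v' - v * u'); rewrite cross_span2 hE scalerA.
  have h0 : h != 0 by rewrite hc mpolyC_eq0.
  have hh : h \is 0.-homog by rewrite hc -[_%:MP]mulr1 mul_mpolyC rpredZ ?dhomog1.
  have dd : (r + d2 = d.-1)%N.
    by rewrite -d1r (cross_degree s1h s2h hE h0 hh).
  rewrite d1r in d12 s1h.
  have -> : (d - r - 1 = d2)%N by rewrite subnAC subn1 -dd addKn.
  split; first by rewrite subn1 -dd mul2n -addnn leq_add2l.
  have -> : homog_part (AR F) d2 = homog_part (combinations s1 s2) d2.
    apply: subv_anti; apply/andP; split; apply: homog_part_subv => //;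
      try exact: AR_linear; try exact: combinations_linear.
      by move=> a _ /gen[[u v] [/= -> _]]; exists u, v.
    by move=> a _ [u [v ->]]; apply: AR_add; apply: AR_scale.
  rewrite (dim_combinations s1h s2h) => [|a _ [u ->] [v uv]]; last first.
    have [] := uniq0 u (- v); first by rewrite scaleNr uv subrr.
    by move=> ->; rewrite scale0r.
  rewrite (dim_multiples_le s1h) // (dim_multiples_le s2h) // subnn; congr ('C(_, _) + _)%N.
  by lia.
move=> [r2d dimr]; set q := (d - r - 1)%N in dimr.
have rq : (r + q = d.-1)%N.
  by rewrite /q; lia.
have rleq : (r <= q)%N by lia.
have [r2 [r2h r2F r2N]] : exists r2, [/\ homog_mx q r2, AR F r2 & ~ multiples r1 r2].
  apply: exists_not_homog_part; [exact: multiples_linear|exact: AR_linear|].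
  rewrite dimr (dim_multiples_le r1h) // addn1 ltnS.
  by rewrite (_ : q - r + 2 = d - 2 * r + 1)%N //; lia.
have [h hE] := crossAR r1F r2F.
have hc := homog0_const (cross_factor_homog (m := 0) r1h r2h hE rq).
set c := h@_0%MM in hc; have c0 : c != 0.
  apply/eqP => c0; apply: r2N; apply: (minimal_syzygy_sat F_homog r1_min).
  by rewrite hE hc c0 mpolyC0 scale0r.
have h0 : h != 0 by rewrite hc mpolyC_eq0.
exists r, q; split=> //; exists r1, r2; split=> // a aF.
have [p pE] := crossAR r1F aF.
have [u uE] : exists u, a - (p * (c^-1)%:MP) *: r2 = u *: r1.
  apply: (minimal_syzygy_sat F_homog r1_min).
  rewrite -scaleNr crossDr crossZr pE hE hc scalerA mulNr -mulrA -mpolyCM mulVf //.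
  by rewrite mpolyC1 mulr1 scaleNr subrr.
exists (u, p * (c^-1)%:MP); split=> [|[u' v'] /= aE].
  by rewrite /= -uE subrK.
have vE : v' = p * (c^-1)%:MP.
  apply: (mulIf h0); apply: (scale_cancel grad0).
  rewrite {2}hc -mulrA -mpolyCM mulVf // mpolyC1 mulr1 -pE aE crossDr !crossZr crossvv.
  by rewrite scaler0 add0r hE scalerA.
rewrite vE; congr (_, _); apply: (scale_cancel r10); rewrite -uE aE vE.
by rewrite addrK.
Qed.

End MinimalSyzygy.
End Exponents.

(** * Nearly free curves *)

Lemma exponent_sum r e d : (r + e = d)%N -> (r <= e)%N ->
  [/\ (d - r = e)%N, (2 * r <= d)%N & (e - r + 2 = d - 2 * r + 2)%N].
Proof. by move=> rd re; split; lia. Qed.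

Lemma exponent_split r d : (0 < d)%N -> (2 * r <= d)%N -> exists q,
  [/\ (r + q = d)%N, (r <= q)%N, (r <= d.-1)%N & q = (d.-1 - r).+1].
Proof. by move=> d0 rd; exists (d - r)%N; split; lia. Qed.

Section NearlyFree.
Variables (K : numFieldType) (F : {mpoly K[3]}) (d : nat).
Local Notation S := {mpoly K[3]}.
Local Notation grad := (mdiff F).
Implicit Types a b : 'rV[S]_3.
Hypothesis d_gt0 : (0 < d)%N.
Hypothesis F_homog : F \is d.-homog.
Hypothesis F_neq0 : F != 0.
Hypothesis F_prime : forall p q, mdivides F (p * q) -> mdivides F p \/ mdivides F q.
Variables (r : nat) (r1 : 'rV[S]_3).
Hypothesis r1_min : minimal_syzygy F r r1.

Let grad0 := grad_neq0 d_gt0 F_homog F_neq0.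
Let gradh := grad_homog F_homog.
Let crossAR := cross_AR d_gt0 F_homog F_neq0 F_prime.

(** The basic relation has linear entries, so no relation has constant ones. *)
Lemma relation_degree0 (s1 s2 s3 : 'rV[S]_3) (h l l' u v w : S) :
  l \is 1.-homog -> l' \is 1.-homog -> independent_forms l l' -> s1 != 0 ->
  (forall u1 u2 u3, u1 *: s1 + u2 *: s2 + u3 *: s3 = 0 ->
     exists g, [/\ u1 = g * h, u2 = g * l & u3 = g * l']) ->
  v \is 0.-homog -> w \is 0.-homog -> u *: s1 + v *: s2 + w *: s3 = 0 ->
  [/\ u = 0, v = 0 & w = 0].
Proof.
move=> lh lh' indep s10 rel v0 w0 E; have [g [-> vE ->]] := rel _ _ _ E.
have l0 := independent_neq0l indep.
suff g0 : g = 0 by rewrite vE g0 !mul0r.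
apply/eqP; apply: contrapT => /negP g0.
have := msize_dhomog (mulf_neq0 g0 l0) (_ : g * l \is 0.-homog).
rewrite -vE => /(_ v0); rewrite vE msizeM // (msize_dhomog l0 lh).
by move/eqP; rewrite addn2 /= eqSS msize_poly_eq0 (negPf g0).
Qed.

(** Taking cross products of the basic relation with [s1] and [s2] shows that the
    factors of the pairs of generators are [l'], [- l] and [h] times a common
    [g], which is a nonzero constant.  Comparing degrees gives
    [d1 + d2 = d]. *)
Lemma nearly_free_necessary : nearly_free_curve F -> (2 * r <= d)%N /\
  \dim (homog_part (AR F) (d - r)) = ('C(d - 2 * r + 2, 2) + 2)%N.
Proof.
have [r1F r1h r10 rmin] := r1_min.
move=> [d1 [d2 [d12 [s1 [s2 [s3 [[s1F s1h] [s2F s2h] [s3F s3h] gen]]]]]]].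
move=> [h [l [l' [_ [lh lh'] indep rel0 rel]]]].
have l0 := independent_neq0l indep; have l0' := independent_neq0r indep.
have s10 : s1 != 0.
  apply/eqP => s10; have [|g [gh /esym/eqP gl _]] := rel 1 0 0.
    by rewrite s10 scaler0 !scale0r !addr0.
  move: gl gh; rewrite mulf_eq0 (negPf l0) orbF => /eqP -> /eqP.
  by rewrite mul0r oner_eq0.
have d1r : d1 = r.
  apply: (minimal_degree_eq r1_min d12 s1F s1h s10) => a /gen[u [v [w aE]]].
  by exists u, s2, s3, v, w.
have [al alE] := crossAR s1F s2F; have [be beE] := crossAR s1F s3F.
have [ga gaE] := crossAR s2F s3F.
have relab : l * al = l' * - be.
  have E : l *: s2 + l' *: s3 = - h *: s1.
    by apply/eqP; rewrite scaleNr -addr_eq0 addrC addrA rel0.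
  have := congr1 (cross s1) E; rewrite crossDr !crossZr crossvv scaler0 alE beE.
  rewrite !scalerA -scalerDl => /(scale_eq0 grad0)/eqP.
  by rewrite addr_eq0 -mulrN => /eqP.
have [g [alg beg]] := independent_coprime lh lh' indep relab.
have gag : ga = h * g.
  have E : h *: s1 + l' *: s3 = - l *: s2.
    by apply/eqP; rewrite scaleNr -addr_eq0 addrAC rel0.
  have := congr1 (cross s2) E.
  rewrite crossDr !crossZr crossvv scaler0 crossNC alE gaE scalerN !scalerA -scaleNr -scalerDl.
  move=> /(scale_eq0 grad0)/eqP; rewrite addrC subr_eq0 alg mulrCA => /eqP.
  exact: mulfI.
have [c c0 gc] : exists2 c : K, c != 0 & g = c%:MP.
  apply: (all_crosses_unit d_gt0 F_homog F_neq0 F_prime) => a b.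
  move=> /gen[u [v [w ->]]] /gen[u' [v' [w' ->]]].
  rewrite cross_span3 alE beE gaE alg (_ : be = - (l * g)) ?gag; last by rewrite -beg opprK.
  exists ((u * v' - v * u') * l' - (u * w' - w * u') * l + (v * w' - w * v') * h).
  by rewrite !scalerA -!scalerDl; congr (_ *: _); ring.
have al0 : al != 0 by rewrite alg mulf_neq0 // gc mpolyC_eq0.
have alh : al \is 1.-homog by rewrite alg gc mulrC mul_mpolyC rpredZ.
have dd : (r + d2 = d)%N.
  by have := cross_degree d_gt0 F_homog F_neq0 s1h s2h alE al0 alh; rewrite d1r add1n prednK.
rewrite d1r in d12 s1h.
have [dr r2d d2r] := exponent_sum dd d12.
rewrite dr; split=> //.
have degree0 u v w := @relation_degree0 s1 s2 s3 h l l' u v w lh lh' indep s10 rel.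
have split23 a : homog_mx d2 a -> combinations s2 s3 a -> exists v w,
    [/\ v \is 0.-homog, w \is 0.-homog & a = v *: s2 + w *: s3].
  move=> ha [v [w aE]]; exists (coef_part d2 d2 v), (coef_part d2 d2 w).
  rewrite -(homog_rowZ _ _ s2h) -(homog_rowZ _ _ s3h) -homog_rowD -aE homog_row_id //.
  by rewrite /coef_part leqnn subnn !pihomogP.
rewrite (dim_homog_part_sum (P1 := multiples s1) (P2 := combinations s2 s3)); first last.
- move=> a ha [u uE] /(split23 _ ha)[v [w [v0 w0 aE]]].
  have [|_ v0' w0'] := degree0 (- u) v w v0 w0; last by rewrite aE v0' w0' !scale0r addr0.
  by rewrite -addrA -aE uE scaleNr addNr.
- move=> a ha /gen[u [v [w aE]]].
  exists (homog_row d2 (u *: s1)), (homog_row d2 (v *: s2 + w *: s3)); split; try exact: homog_rowP.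
  + by rewrite (homog_rowZ _ _ s1h); eexists.
  + by rewrite homog_rowD (homog_rowZ _ _ s2h) (homog_rowZ _ _ s3h); eexists; eexists.
  + by rewrite -homog_rowD addrA -aE homog_row_id.
- by move=> a _ [u [v ->]]; apply: AR_add; apply: AR_scale.
- by move=> a _ [u ->]; apply: AR_scale.
- exact: combinations_linear.
- exact: multiples_linear.
- exact: AR_linear.
have s20 : s2 != 0.
  apply/eqP => s20; have [|_ /eqP + _] := degree0 0 1 0 (dhomog1 _ _) (rpred0 _).
    by rewrite s20 scaler0 !scale0r !addr0.
  by rewrite oner_eq0.
have s30 : s3 != 0.
  apply/eqP => s30; have [|_ _ /eqP] := degree0 0 0 1 (rpred0 _) (dhomog1 _ _).
    by rewrite s30 scaler0 !scale0r !addr0.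
  by rewrite oner_eq0.
rewrite (dim_combinations s2h s3h) => [|a ha a2 a3]; last first.
  have [v v0 aE] := homog_multiple_le s2h ha a2 (leqnn _).
  have [w w0 aE'] := homog_multiple_le s3h ha a3 (leqnn _).
  rewrite subnn in v0 w0; have [||_ v00 _] := degree0 0 v (- w) v0; first by rewrite rpredN.
    by rewrite scale0r add0r scaleNr -aE -aE' subrr.
  by rewrite aE v00 scale0r.
rewrite (dim_multiples_le s1h) // (dim_multiples_le s2h) // (dim_multiples_le s3h) // subnn.
by rewrite d2r.
Qed.

(** Two further syzygies whose factors against [r1] are independent linear forms.
    The ideal of all factors against [r1] then contains [(l, l')], and it turns
    out to be either this ideal or the unit ideal. *)
Section ThreeGenerators.
Variables (r2 r3 : 'rV[S]_3) (l l' h : S).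
Hypothesis r2F : AR F r2.
Hypothesis r3F : AR F r3.
Hypothesis lh : l \is 1.-homog.
Hypothesis lh' : l' \is 1.-homog.
Hypothesis indep : independent_forms l l'.
Hypothesis cross12 : cross r1 r2 = l' *: grad.
Hypothesis cross13 : cross r1 r3 = - l *: grad.
Hypothesis rel0 : h *: r1 + l *: r2 + l' *: r3 = 0.

Let l0 : l != 0 := independent_neq0l indep.
Let l0' : l' != 0 := independent_neq0r indep.
Let r1F : AR F r1. Proof. by have [] := r1_min. Qed.
Let r10 : r1 != 0. Proof. by have [] := r1_min. Qed.

(** The cross product with [r1] turns the relation into a relation between the
    coprime forms [l] and [l']. *)
Lemma relations_generated u1 u2 u3 : u1 *: r1 + u2 *: r2 + u3 *: r3 = 0 ->
  exists g, [/\ u1 = g * h, u2 = g * l & u3 = g * l'].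
Proof.
move=> E; have E' : u2 *: r2 + u3 *: r3 = - u1 *: r1.
  by apply/eqP; rewrite scaleNr -addr_eq0 addrC addrA E.
have := congr1 (cross r1) E'; rewrite crossDr !crossZr crossvv scaler0 cross12 cross13.
rewrite !scalerA -scalerDl => /(scale_eq0 grad0)/eqP.
rewrite mulrN subr_eq0 mulrC [u3 * _]mulrC => /eqP ul.
have [g [gu3 gu2]] := independent_coprime lh lh' indep (esym ul).
exists g; rewrite gu2 gu3 ![g * _]mulrC; split=> //.
apply: (scale_cancel r10); have F1 : l *: r2 + l' *: r3 = - h *: r1.
  by apply/eqP; rewrite scaleNr -addr_eq0 addrC addrA rel0.
apply: oppr_inj; rewrite -!scaleNr -E' gu2 gu3 ![_ * g]mulrC -!scalerA -scalerDr F1.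
by rewrite scalerA mulrN.
Qed.

(** Let [p] be the factor of [cross r1 a].  If [p] lies in [(l, l')], subtracting
    multiples of [r2] and [r3] from [a] leaves a multiple of [r1].  Otherwise
    [l], [l'], [p] behave as a regular sequence, and the Koszul relations among
    them allow to modify [r2] by a multiple of [r1] so that it becomes divisible
    by [l']; the quotient [rho] has factor 1 against [r1]. *)
Lemma generated_or_free a : AR F a ->
  (exists u1 u2 u3, a = u1 *: r1 + u2 *: r2 + u3 *: r3) \/
  (exists2 rho, AR F rho & cross r1 rho = grad).
Proof.
move=> aF; have [p pE] := crossAR r1F aF.
have sat b : cross r1 b = 0 -> exists u, b = u *: r1 := minimal_syzygy_sat F_homog r1_min.
have [[x [y E]]|pN] := EM (exists x y, p = x * l + y * l').
  left; have [|u uE] := sat (a + (- y *: r2 + x *: r3)).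
    rewrite !crossDr !crossZr pE cross12 cross13 !scalerA -!scalerDl E.
    by rewrite (_ : _ + _ = 0) ?scale0r //; ring.
  exists u, y, (- x); rewrite -uE !scaleNr -[RHS]addrA.
  by rewrite [- _ + _]addrC -opprB subrK.
right; have [A AE] : exists A, p *: r2 - l' *: a = A *: r1.
  apply: sat; rewrite -scaleNr crossDr !crossZr cross12 pE !scalerA mulNr.
  by rewrite [l' * p]mulrC scaleNr subrr.
have [B BE] : exists B, p *: r3 + l *: a = B *: r1.
  by apply: sat; rewrite crossDr !crossZr cross13 pE !scalerA mulrN [l * p]mulrC scaleNr addNr.
have F1 : l *: r2 + l' *: r3 = - h *: r1.
  by apply/eqP; rewrite scaleNr -addr_eq0 addrC addrA rel0.
(* Eliminate [a] between the two equations, then use the relation of [r1], [r2], [r3]. *)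
have ABh : l * A + l' * B = - (p * h).
  apply: (scale_cancel r10); rewrite scalerDl -!scalerA -AE -BE scalerBr scalerDr !scalerA.
  rewrite [l * p]mulrC [l' * p]mulrC [l * l']mulrC addrACA addNr addr0.
  by rewrite -!scalerA -scalerDr F1 scalerA mulrN.
have [//|[x [y hE]]] : (exists x y, p = x * l + y * l') \/ (exists x y, h = x * l + y * l').
  apply: (independent_forms_prime lh lh' indep); exists (- A), (- B).
  by rewrite -[LHS]opprK -ABh; ring.
(* With [h = x l + y l'], the previous identity becomes a relation between [l] and [l']. *)
have [|ga [gaE _]] := @independent_coprime _ _ _ lh lh' indep (A + p * x) (- (B + p * y)).
  apply/eqP; rewrite -subr_eq0; apply/eqP.
  by transitivity (l * A + l' * B + p * h); [rewrite hE; ring|rewrite ABh addNr].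
have key : p *: (r2 + x *: r1) = l' *: (a + ga *: r1).
  rewrite !scalerDr !scalerA -gaE scalerDl -AE.
  by rewrite addrA [_ *: a + _]addrC subrK.
have dvd i : mdivides l' ((r2 + x *: r1) 0 i).
  have [||//] := @linear_form_prime _ l' p ((r2 + x *: r1) 0 i) lh' l0'.
    exists ((a + ga *: r1) 0 i).
    by have /rowP/(_ i) := key; rewrite [LHS]mxE [RHS]mxE => ->; rewrite mulrC.
  by move=> [k kE]; case: pN; exists 0, k; rewrite mul0r add0r.
have [rho rhoE] := choice dvd.
have rE : r2 + x *: r1 = l' *: \row_i rho i.
  by apply/rowP => i; rewrite rhoE !mxE mulrC.
exists (\row_i rho i).
  by apply: (AR_cancel l0'); rewrite -rE; apply: AR_add => //; apply: AR_scale.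
apply/rowP => i; apply: (mulfI l0').
have := congr1 (cross r1) rE; rewrite crossDr !crossZr crossvv scaler0 addr0 cross12.
by move/rowP/(_ i); rewrite [LHS]mxE [RHS]mxE => ->.
Qed.

End ThreeGenerators.

(** The dimension hypothesis provides [r2] and [r3], independent modulo [r1], whose
    factors against [r1] are linear.  If they did not generate with [r1], a
    syzygy [rho] with factor 1 would exist, and its multiples by the three
    coordinates would make the dimension exceed the given one. *)
Lemma nearly_free_sufficient : (2 * r <= d)%N ->
  \dim (homog_part (AR F) (d - r)) = ('C(d - 2 * r + 2, 2) + 2)%N ->
  nearly_free_curve F.
Proof.
have [r1F r1h r10 rmin] := r1_min; move=> r2d.
have [q [rq rleq rd1 qe']] := exponent_split d_gt0 r2d.
have [-> _ <-] := exponent_sum rq rleq => dimr.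
have rq1 : (r + q = 1 + d.-1)%N by rewrite rq add1n prednK.
have [r2 [r2h r2F r2N]] : exists r2, [/\ homog_mx q r2, AR F r2 & ~ multiples r1 r2].
  apply: exists_not_homog_part; [exact: multiples_linear|exact: AR_linear|].
  by rewrite dimr (dim_multiples_le r1h) // -addn1 leq_add2l.
have r20 : r2 != 0 by apply/eqP => r20; apply: r2N; exists 0; rewrite r20 scale0r.
have [r3 [r3h r3F r3N]] : exists r3, [/\ homog_mx q r3, AR F r3 & ~ combinations r1 r2 r3].
  apply: exists_not_homog_part; [exact: combinations_linear|exact: AR_linear|].
  rewrite dimr (dim_combinations r1h r2h) => [|a ha a1 a2]; last first.
    have [v v0 aE] := homog_multiple_le r2h ha a2 (leqnn _).
    rewrite subnn in v0; have := homog0_const v0; set c := v@_0%MM => vc; have [c0|c0] := eqVneq c 0.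
      by rewrite aE vc c0 mpolyC0 scale0r.
    case: r2N; have [u uE] := a1; exists ((c^-1)%:MP * u).
    by rewrite -scalerA -uE aE vc scalerA -mpolyCM mulVf // mpolyC1 scale1r.
  by rewrite (dim_multiples_le r1h) // (dim_multiples_le r2h) // subnn binn ltn_add2l.
have [l' l'E] := crossAR r1F r2F; have [m mE] := crossAR r1F r3F.
have lh' := cross_factor_homog d_gt0 F_homog F_neq0 r1h r2h l'E rq1.
have mh := cross_factor_homog d_gt0 F_homog F_neq0 r1h r3h mE rq1.
pose l := - m; have lh : l \is 1.-homog by rewrite rpredN.
have sat b : cross r1 b = 0 -> exists u, b = u *: r1 := minimal_syzygy_sat F_homog r1_min.
have crossl : cross r1 r3 = - l *: grad by rewrite opprK.
have indep : independent_forms l l'.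
  move=> c c' cl; have [|u uE] := sat (c'%:MP *: r2 - c%:MP *: r3).
    rewrite -scaleNr crossDr !crossZr l'E mE !scalerA -scalerDl.
    have E : c'%:MP * l' + - c%:MP * m = c *: l + c' *: l'.
      by rewrite -!mul_mpolyC /l; ring.
    by rewrite E cl scale0r.
  have c0 : c = 0.
    apply: contrapT => /eqP c0; apply: r3N.
    exists (- (c^-1)%:MP * u), ((c^-1)%:MP * c'%:MP).
    rewrite -scalerA -uE -scalerA scaleNr -scalerN opprB scalerBr subrK scalerA.
    by rewrite -mpolyCM mulVf // mpolyC1 scale1r.
  split=> //; apply: contrapT => /eqP c'0; apply: r2N; exists ((c'^-1)%:MP * u).
  move: uE; rewrite c0 mpolyC0 scale0r subr0 => uE.
  by rewrite -scalerA -uE scalerA -mpolyCM mulVf // mpolyC1 scale1r.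
have [u uE] : multiples r1 (- (l *: r2 + l' *: r3)).
  apply: sat; rewrite -scaleN1r crossZr crossDr !crossZr l'E crossl !scalerA -scalerDl.
  by rewrite mulrN [l' * l]mulrC subrr scale0r scaler0.
have [h hh hE] : exists2 h, h \is (q + 1 - r).-homog & - (l *: r2 + l' *: r3) = h *: r1.
  apply: (homog_multiple_le r1h); [|by exists u|exact: leq_trans rleq (leq_addr _ _)].
  rewrite [(q + 1)%N]addnC => i j; rewrite mxE rpredN; apply: homogD; exact: homogZ.
have rel0 : h *: r1 + l *: r2 + l' *: r3 = 0 by rewrite -hE -addrA addNr.
exists r, q; split=> //; exists r1, r2, r3; split=> //; last first.
  exists h, l, l'; split; [exact: hh|by split|exact: indep|exact: rel0|].
  exact: (relations_generated lh lh' indep l'E crossl rel0).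
move=> a /(generated_or_free r2F lh lh' indep l'E crossl rel0)[//|[rho rhoF rhoE]].
(* [r2] and [r3] do not generate, so [rho] and [r1] form a basis and the dimension is too large. *)
exfalso; pose e := (d.-1 - r)%N; have qe : q = e.+1 := qe'.
pose rho' := homog_row e rho.
have rho'F : AR F rho' := AR_homog_row F_homog _ rhoF.
have rho'E : cross r1 rho' = grad.
  by rewrite /rho' -(homog_row_cross _ _ r1h) rhoE subnKC // homog_row_id.
have rho'0 : rho' != 0.
  by apply: contraNneq grad0 => rho0; rewrite -rho'E rho0 cross0r.
have rho'h : homog_mx e rho' by apply: homog_rowP.
have sub : (homog_part (combinations r1 rho') q <= homog_part (AR F) q)%VS.
  apply: homog_part_subv; [exact: combinations_linear|exact: AR_linear|].
  by move=> a' _ [x [y ->]]; apply: AR_add; apply: AR_scale.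
have := dimvS sub; rewrite dimr (dim_combinations r1h rho'h) => [|a' _ [x ->] [y yE]]; last first.
  have := congr1 (cross r1) yE; rewrite !crossZr crossvv scaler0 rho'E.
  by move=> /esym/(scale_eq0 grad0) y0; rewrite yE y0 scale0r.
rewrite (dim_multiples_le r1h) // (dim_multiples_le rho'h rho'0) -/e qe ?leqnSn //.
by rewrite leq_add2l subSnn.
Qed.

Theorem nearly_free_iff : nearly_free_curve F <-> (2 * r <= d)%N /\
  \dim (homog_part (AR F) (d - r)) = ('C(d - 2 * r + 2, 2) + 2)%N.
Proof.
by split=> [|[r2d dimr]]; [apply: nearly_free_necessary|apply: nearly_free_sufficient].
Qed.

End NearlyFree.

(** * The theorem *)

Section CurveData.
Variable K : numClosedFieldType.
Variables (d : nat) (f : 3.-tuple {mpoly K[2]}) (F : {mpoly K[3]}).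
Hypothesis d_gt0 : (0 < d)%N.
Hypothesis f_homog : forall i, tnth f i \is d.-homog.
Hypothesis F_homog : F \is d.-homog.
Hypothesis F_eq : reduced_equation f F.

Lemma reduced_equation_neq0 : F != 0.
Proof.
apply/eqP => F0; have [F_sqf _] := F_eq.
have /unitrP[y [_ Xy]] : ('X_0 : {mpoly K[3]}) \is a GRing.unit.
  by apply: F_sqf; exists 0; rewrite F0 mul0r.
have := congr1 (meval (fun=> 0)) Xy; rewrite mevalM mevalXU mul0r meval1 => /eqP.
by rewrite eq_sym oner_eq0.
Qed.

Lemma meval_homog0 n (p : {mpoly K[n]}) (v : 'I_n -> K) : p \is d.-homog ->
  (forall i, v i = 0) -> p.@[v] = 0.
Proof.
move=> ph v0; rewrite (@meval_eq _ _ _ (fun i => 0 * v i)) => [|i].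
  by rewrite (meval_homog _ _ ph) expr0n gtn_eqF // mul0r.
by rewrite v0 mulr0.
Qed.

Lemma reduced_equation_comp : F \mPo f = 0.
Proof.
apply: mpoly_eq0_eval => v; rewrite comp_mpoly_meval; pose u : 'rV[K]_2 := \row_i v i.
have uE : u 0 =1 v by move=> i; rewrite mxE.
rewrite -(@meval_eq _ _ (eval_map f u 0)) => [|i]; last by rewrite mxE (meval_eq _ uE).
have [p0|p0] := eqVneq (eval_map f u) 0.
  by rewrite p0; apply: meval_homog0 => // i; rewrite mxE.
apply/(F_eq.2 _ p0); exists u; last by exists 1; rewrite ?oner_neq0 ?scale1r.
apply: contraNneq p0 => u0; apply/eqP/rowP => i; rewrite !mxE.
by apply: meval_homog0 => // j; rewrite u0 mxE.
Qed.

Lemma exists_minimal_syzygy : exists r1, minimal_syzygy F (mdr F) r1.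
Proof.
have [Fr Fmin] := mdrP F_homog.
have [r1 [r1h r1F r10]] : exists r1, [/\ homog_mx (mdr F) r1, AR F r1 & r1 <> 0].
  apply: contrapT => nr; case/eqP: Fr; apply/(homog_part_eq0P _ (AR_linear F)) => a ha aF.
  by apply: contrapT => a0; apply: nr; exists a.
exists r1; split=> // [|q a aF ha a0]; first exact/eqP.
exact/Fmin/(homog_part_neq0 (AR_linear F) aF ha a0).
Qed.

End CurveData.

Theorem theorem4p5 (R : realType) (d : nat)
    (f : 3.-tuple {mpoly R[i][2]}) (F : {mpoly (complex R)[3]})
    (d_ge2 : (2 <= d)%N)
    (f_homog : forall i, tnth f i \is d.-homog)
    (f_gcd : gcd_is_one f)
    (f_inj : generically_injective f)
    (F_homog : F \is d.-homog)
    (F_eq : reduced_equation f F) :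
  let a := dim_pullback_ker f in
  [/\ forall q : nat,
        a q = \dim (homog_part (ARE F) q) /\
        \dim (homog_part (ARE F) q) =
          ('C(q + 1, 2) + \dim (homog_part (AR F) q))%N,
      forall r : nat,
        r = mdr F <->
        (forall q : nat, (q < r)%N -> a q = 'C(q + 1, 2)) /\
        ('C(r + 1, 2) < a r)%N,
      let r := mdr F in
        free_curve F <->
        (2 * r <= d - 1)%N /\
        a (d - r - 1)%N = ('C(d - r, 2) + 'C(d - 2 * r + 1, 2) + 1)%N &
      let r := mdr F in
        nearly_free_curve F <->
        (2 * r <= d)%N /\
        a (d - r)%N = ('C(d - r + 1, 2) + 'C(d - 2 * r + 2, 2) + 2)%N].
Proof.
have d_gt0 : (0 < d)%N by apply: leq_trans d_ge2.
have F0 := reduced_equation_neq0 F_eq.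
have Ff := reduced_equation_comp d_gt0 f_homog F_homog F_eq.
have prime := equation_prime d_gt0 f_homog f_gcd f_inj F_homog F0 Ff.
have [r1 r1min] := exists_minimal_syzygy F_homog.
have [mdr_neq0 mdr_min] := mdrP F_homog.
move=> a.
have aE q : a q = \dim (homog_part (ARE F) q).
  exact: (dim_pullback_ker_ARE d_gt0 f_homog f_gcd f_inj F_homog F0 Ff).
have dimE := dim_ARE d_gt0 F_homog F0.
have a_dim q : a q = ('C(q + 1, 2) + \dim (homog_part (AR F) q))%N by rewrite aE dimE.
split=> [q|r|r|r].
- by rewrite aE dimE.
- split=> [->|[ltr ger]].
    split=> [q qr|]; last by rewrite a_dim -[X in (X < _)%N]addn0 ltn_add2l lt0n dimv_eq0.
    rewrite a_dim; suff /eqP -> : homog_part (AR F) q == 0%VS by rewrite dimv0 addn0.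
    by apply: contraLR qr => /mdr_min; rewrite -leqNgt.
  have : homog_part (AR F) r != 0%VS.
    by move: ger; rewrite a_dim -[X in (X < _)%N]addn0 ltn_add2l lt0n dimv_eq0.
  move=> /mdr_min; rewrite leq_eqVlt => /orP[/eqP //|/ltr/eqP].
  by rewrite a_dim -[X in _ == X]addn0 eqn_add2l dimv_eq0 (negPf mdr_neq0).
- rewrite (free_iff d_gt0 F_homog F0 prime r1min) a_dim -/r.
  split=> -[rd]; have -> : (d - r - 1 + 1 = d - r)%N by lia.
    by move=> ->; rewrite addnA.
  by move=> /eqP; rewrite -addnA eqn_add2l => /eqP.
- rewrite (nearly_free_iff d_gt0 F_homog F0 prime r1min) a_dim -/r.
  split=> -[rd]; first by move=> ->; rewrite addnA.
  by move=> /eqP; rewrite -addnA eqn_add2l => /eqP.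
Qed.
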